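(* Let $\mathcal M=(\mathcal Q,\mathcal E,\mathcal N)$ be a T-mesh generated by the procedure REFINE from the initial mesh $\mathcal M_0$, and let $E\in\mathcal E$. Let $E'$ be any new edge, i.e. an edge of $\mathrm{REFINE}(\mathcal M,E)$ that is not an edge of $\mathcal M$. Let $E=E_J,E_{J-1},\dots,E_0$ ($J\ge 0$) be the chain of nested recursive calls in the execution of $\mathrm{REFINE}(\mathcal M,E)$ that leads to the subdivision of the edge $E_0$ in which $E'$ is created; that is, for $j=1,\dots,J$ the call of REFINE on $E_{j-1}$ is made directly by the call of REFINE on $E_j$, so that $E_{j-1}$ lies in the neighborhood of $E_j$ in the current mesh and either $\ell(E_{j-1})<\ell(E_j)$, or $\ell(E_{j-1})=\ell(E_j)$ and $\mathrm{di}(E_{j-1})<\mathrm{di}(E_j)$. Let $K=\#\{\mathrm{di}(E_0),\dots,\mathrm{di}(E_J)\}$ be the number of distinct direction indices in this chain. Then $$\mathrm{dist}(E,E')<C\,2^{-\ell(E')}\qquad\text{and}\qquad \ell(E')\le \ell(E)+1,$$ where $$C=\tfrac12+\frac{2}{2^{1/K}(2^{1/K}-1)}\,(p+1)<c\,K(p+1)$$ with a constant $c$ that does not depend on the mesh $\mathcal M$, on $K$, or on $p$.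
   Context: Throughout, $p\ge1$ is an odd integer (the polynomial degree). Meshes. $\Omega\subset\mathbb R^2$ is an open bounded domain with polygonal boundary. (More generally, $\Omega$ may be a two-dimensional domain or orientable surface in $\mathbb R^d$ partitioned into curved quadrilaterals with the same combinatorics.) A mesh $\mathcal M=(\mathcal Q,\mathcal E,\mathcal N)$ partitions $\Omega$ and its boundary into finitely many pairwise disjoint open quadrilateral elements, open edges (without end points) and nodes. For an element $Q$, $\mathcal E(Q)$ and $\mathcal N(Q)$ denote the edges and nodes contained in $\partial Q$. The mesh is regular if every element has exactly four edges and four nodes and the closures of any two distinct elements are disjoint, share exactly one edge and its two nodes, or share exactly one node. The initial mesh $\mathcal M_0$ is regular. Each element $Q$ of $\mathcal M_0$ is the image of the parameter domain $(0,1)^2$ under a regular, positively oriented $C^\infty$-map, and the maps of two elements sharing an edge fit together continuously along it (up to Euclidean motions of the parameter domains). All edges of $\mathcal M_0$ have length $1$. Bisections and midpoints of edges and elements are understood in parameter coordinates. T-meshes are obtained from $\mathcal M_0$ by successive edge bisections and element bisections as in SUBDIV below. SUBDIV$(\mathcal M,E)$: bisect $E$ at its midpoint $\mathrm{mid}(E)$, i.e. remove $E$, add its two children $E_1,E_2$ and the node $\mathrm{mid}(E)$. For each of the (at most two) elements $Q$ neighboring $E$: if the edge opposite to $E$ in $Q$ has already been subdivided, add a new edge $\tilde E$ connecting the midpoints of $E$ and of this opposite edge, and replace $Q$ by the two elements into which $\tilde E$ divides it. Refinement level $\ell$: $\ell(E)=0$ for all edges of $\mathcal M_0$; children satisfy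 $\ell(E_1)=\ell(E_2)=\ell(E)+1$; a new edge $\tilde E$ has the same level as its opposite edges. Direction index $\mathrm{di}$: it is assumed that there is a map $\mathrm{di}$ from the edges of $\mathcal M_0$ to $\mathbb N$ (a direction labeling) such that in every element opposite edges have equal values and neighboring (adjacent) edges have distinct values. Children inherit the direction index of their parent, and a new edge $\tilde E$ has the direction index of its opposite edges. Mesh metric: let $\mathcal M_{[0]}=\mathcal M_0$ and let $\mathcal M_{[j+1]}$ be the uniform dyadic refinement of $\mathcal M_{[j]}$ (every element split into four). For nodes $A\ne B$ of $\mathcal M_{[j]}$, let $\mathrm{dist}_{[j]}(A,B)$ be the minimal $n$ such that there is a sequence of $n$ elements of $\mathcal M_{[j]}$, consecutive ones sharing a vertex, with $A$ a vertex of the first and $B$ a vertex of the last; $\mathrm{dist}_{[j]}(A,A)=0$. Then $\mathrm{dist}(A,B)=2^{-j}\mathrm{dist}_{[j]}(A,B)$ defines a metric on the union of all nodes of all $\mathcal M_{[j]}$, extended continuously to $\Omega$. For edges, $\mathrm{dist}(E,E')=\mathrm{dist}(\mathrm{mid}(E),\mathrm{mid}(E'))$. Edge neighborhood: $\mathrm{neighb}(\mathcal M,E)=\{E'\in\mathcal E\mid \mathrm{dist}(E,E')\le\frac{p+1}{2}\,2^{-\ell(E)}\}$. REFINE$(\mathcal M,E)$: while there is $E'\in\mathrm{neighb}(\mathcal M,E)$ with $\ell(E')<\ell(E)$, or with $\ell(E')=\ell(E)$ and $\mathrm{di}(E')<\mathrm{di}(E)$, do: for all $E'\in\mathrm{neighb}(\mathcal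 M,E)$ satisfying one of these two conditions, set $\mathcal M\leftarrow\mathrm{REFINE}(\mathcal M,E')$. After the loop, set $\mathcal M\leftarrow\mathrm{SUBDIV}(\mathcal M,E)$ and return $\mathcal M$. A mesh is generated by REFINE if it is obtained from $\mathcal M_0$ by finitely many successive calls of REFINE on edges of the current mesh. *)

(* Defs.v *)
From HB Require Import structures.
From mathcomp Require Import all_boot all_order all_algebra.
From mathcomp Require Import all_classical all_reals all_analysis.

Set Implicit Arguments.
Unset Strict Implicit.
Unset Printing Implicit Defensive.

Import Order.TTheory GRing.Theory Num.Theory.
Import numFieldNormedType.Exports.

Local Open Scope classical_set_scope.
Local Open Scope ring_scope.

Section ParameterDomain.
Variable R : realType.
Implicit Types (a b lo hi : R * R) (i : 'I_4).

Definition open_square : set (R * R) :=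
  [set x | 0 < x.1 < 1 /\ 0 < x.2 < 1].

Definition closed_square : set (R * R) :=
  [set x | 0 <= x.1 <= 1 /\ 0 <= x.2 <= 1].

(* Corners are indexed counterclockwise by Z/4, starting at [lo]; side [i] runs
   from corner [i] to corner [i + 1], so that the sides [i] and [i + 2] are
   opposite and the sides with even index are the horizontal ones. *)
Definition corner lo hi i : R * R :=
  (if (i == 1) || (i == 2) then hi.1 else lo.1,
   if (2 <= i)%N then hi.2 else lo.2).

Definition affine a b (t : R) : R * R :=
  ((1 - t) * a.1 + t * b.1, (1 - t) * a.2 + t * b.2).

Definition midpt a b : R * R := affine a b 2^-1.

(* [C^k] on [U], through existence and continuity of iterated partial
   derivatives. *)
Fixpoint Ck d (U : set (R * R)) (k : nat) (f : R * R -> 'rV[R]_d) : Prop :=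
  match k with
  | 0 => forall x, U x -> continuous_at x f
  | k'.+1 =>
      [/\ forall x, U x -> derivable f x (1, 0) /\ derivable f x (0, 1),
          Ck U k' (fun x => 'D_(1, 0) f x) &
          Ck U k' (fun x => 'D_(0, 1) f x)]
  end.

End ParameterDomain.

(* A regular mesh of curved quadrilaterals in R^d, with a direction labeling.
   An element is indexed by [Q : cell] and parametrized by [par Q]. *)
Record initial_mesh (R : realType) (d : nat) := InitialMesh {
  cell : finType;
  Omega : set 'rV[R]_d;
  par : cell -> R * R -> 'rV[R]_d;
  par_smooth : forall Q k, Ck (@open_square R) k (par Q);
  par_regular : forall Q x, @open_square R x ->
    row_free (col_mx ('D_(1, 0) (par Q) x) ('D_(0, 1) (par Q) x));
  par_continuous : forall Q,
    {within @closed_square R, continuous (par Q)};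
  (* four distinct nodes and four disjoint edges on the boundary *)
  par_inj : forall Q x y, @closed_square R x -> @closed_square R y ->
    par Q x = par Q y -> x = y;
  elements_in_Omega : forall Q, par Q @` @open_square R `<=` Omega;
  elements_cover : closure Omega = \bigcup_Q (par Q @` @closed_square R);
  (* The closures of two elements are disjoint, share exactly one edge, or share
     exactly one node. The maps agree along a shared edge up to a Euclidean
     motion of the parameter domains; the reversed orientation [1 - t] expresses
     that both maps are positively oriented. *)
  mesh_regular : forall Q Q', Q != Q' ->
    let path P (i : 'I_4) t :=
      par P (affine (corner (0, 0) (1, 1) i) (corner (0, 0) (1, 1) (i + 1)) t)
    in
    let shared := par Q @` @closed_square R `&` par Q' @` @closed_square R in
    [\/ shared = set0,
        exists i j, shared = path Q i @` [set t : R | 0 <= t <= 1] /\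
          (forall t : R, 0 <= t <= 1 -> path Q i t = path Q' j (1 - t)) |
        exists i j, shared = [set path Q i 0] /\ path Q i 0 = path Q' j 0];
  (* direction index of the (open) edges of the mesh *)
  di0 : set 'rV[R]_d -> nat;
  di0_labeling : forall Q,
    let side (i : 'I_4) : set 'rV[R]_d :=
      [set par Q (affine (corner (0, 0) (1, 1) i)
                         (corner (0, 0) (1, 1) (i + 1)) t) | t in `]0, 1[]
    in
    forall i, di0 (side i) = di0 (side (i + 2)) /\
              di0 (side i) <> di0 (side (i + 1))
}.

(* An edge is an open arc, carrying its refinement level and direction index. *)
Record edge (R : realType) (d : nat) := Edge {
  locus : set 'rV[R]_d;
  level : nat;
  di : nat
}.

HB.instance Definition _ (R : realType) (d : nat) :=
  gen_eqMixin (edge R d).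

(* The element [par base (]lo.1, hi.1[ x ]lo.2, hi.2[)], together with the
   refinement level and the direction index of its horizontal (h) and vertical
   (v) sides. *)
Record element (R : realType) (d : nat) (M0 : initial_mesh R d) := Element {
  base : cell M0;
  lo : R * R;
  hi : R * R;
  hlevel : nat;
  vlevel : nat;
  hdi : nat;
  vdi : nat
}.

Record mesh (R : realType) (d : nat) (M0 : initial_mesh R d) := Mesh {
  elements : set (element M0);
  edges : set (edge R d);
  nodes : set 'rV[R]_d
}.

Section Refinement.
Variables (R : realType) (d : nat) (M0 : initial_mesh R d).
Implicit Types (M : mesh M0) (E F : edge R d) (q : element M0).
Implicit Types (P Q : cell M0) (A B V : 'rV[R]_d) (i : 'I_4).

Definition seg Q (a b : R * R) : set 'rV[R]_d :=
  [set par Q (affine a b t) | t in `]0, 1[].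

(* The sides of an element, as edges. A side need not be an edge of the current
   mesh any more: it may already have been subdivided. *)
Definition side q i : edge R d :=
  Edge (seg (base q) (corner (lo q) (hi q) i) (corner (lo q) (hi q) (i + 1)))
       (if odd i then vlevel q else hlevel q)
       (if odd i then vdi q else hdi q).

Definition vertices q : set 'rV[R]_d :=
  [set par (base q) (corner (lo q) (hi q) i) | i in [set: 'I_4]].

(* The midpoint in parameter coordinates; it does not depend on the
   parametrization of the edge that is used. *)
Definition mid E : 'rV[R]_d :=
  xget 0 [set m | exists Q a b,
    [/\ closed_square a, closed_square b, locus E = seg Q a b &
        m = par Q (midpt a b)]].

(* Two edges, as [a] and [b] may be exchanged. *)
Definition children E : set (edge R d) :=
  [set F | exists Q a b,
    [/\ closed_square a, closed_square b, locus E = seg Q a b &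
        F = Edge (seg Q a (midpt a b)) (level E).+1 (di E)]].

(* The edge from the midpoint of side [i] of [q] to that of side [i + 2]. Its
   opposite edges are the sides [i + 1] and [i + 3]. *)
Definition bisector q i : edge R d :=
  let c := corner (lo q) (hi q) in
  Edge (seg (base q) (midpt (c i) (c (i + 1)))
                     (midpt (c (i + 2)) (c (i + 3))))
       (level (side q (i + 1))) (di (side q (i + 1))).

(* The two elements into which [bisector q i] divides [q]; the sides [i] and
   [i + 2] are halved. *)
Definition halves q i : set (element M0) :=
  let: Element Q l h hl vl hd vd := q in
  let m := midpt l h in
  if odd i then
    [set Element Q l (h.1, m.2) hl vl.+1 hd vd;
         Element Q (l.1, m.2) h hl vl.+1 hd vd]
  else
    [set Element Q l (m.1, h.2) hl.+1 vl hd vd;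
         Element Q (m.1, l.2) h hl.+1 vl hd vd].

Definition initial_element Q : element M0 :=
  let s i := seg Q (corner (0, 0) (1, 1) i) (corner (0, 0) (1, 1) (i + 1)) in
  Element Q (0, 0) (1, 1) 0 0 (di0 M0 (s 0)) (di0 M0 (s 1)).

Definition mesh0 : mesh M0 :=
  let els := range initial_element in
  Mesh els [set side q i | q in els & i in [set: 'I_4]]
       (\bigcup_(q in els) vertices q).

Definition to_split M E q i : Prop :=
  [/\ elements M q, side q i = E & ~ edges M (side q (i + 2))].

Definition subdiv M E : mesh M0 :=
  Mesh
    ([set q | elements M q /\ ~ exists i, to_split M E q i] `|`
     [set q' | exists q i, to_split M E q i /\ halves q i q'])
    (edges M `\ E `|` children E `|`
     [set F | exists q i, to_split M E q i /\ F = bisector q i])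
    (nodes M `|` [set mid E]).

(* The elements of the [j]-th uniform dyadic refinement of the initial mesh. *)
Fixpoint uniform (j : nat) : set (element M0) :=
  match j with
  | 0 => range initial_element
  | j'.+1 => [set q'' | exists q q',
                [/\ uniform j' q, halves q 0 q' & halves q' 1 q'']]
  end.

Definition uniform_nodes (j : nat) : set 'rV[R]_d :=
  \bigcup_(q in uniform j) vertices q.

(* [s] is a sequence of elements, consecutive ones sharing a vertex, with [A] a
   vertex of the first and [B] a vertex of the last; [A = B] if [s] is empty. *)
Fixpoint joins (j : nat) A (s : seq (element M0)) B : Prop :=
  match s with
  | [::] => A = B
  | q :: s' => [/\ uniform j q, vertices q A &
                   exists V, vertices q V /\ joins j V s' B]
  end.

(* [+oo] if [A] and [B] are not connected by any sequence of elements. *)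
Definition dist_level (j : nat) A B : \bar R :=
  ereal_inf [set (size s)%:R%:E | s in [set s | joins j A s B]].

(* Any [j] for which [A] and [B] are nodes of the [j]-th uniform refinement gives
   the same value. Only midpoints of edges are compared, and these are nodes of
   some uniform refinement, so the continuous extension is not needed. *)
Definition dist A B : \bar R :=
  let j := xget 0%N [set j | uniform_nodes j A /\ uniform_nodes j B] in
  ((2 ^- j)%:E * dist_level j A B)%E.

Definition edge_dist E F : \bar R := dist (mid E) (mid F).

Definition neighb (p : nat) M E : set (edge R d) :=
  [set F | edges M F /\
     (edge_dist E F <= (p.+1%:R / 2 * 2 ^- level E)%:E)%E].

Definition precedes F E : Prop :=
  (level F < level E)%N \/ level F = level E /\ (di F < di E)%N.

Definition pending (p : nat) M E : set (edge R d) :=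
  [set F | neighb p M E F /\ precedes F E].

(* Big-step semantics of REFINE, for any order in which the for-loops are run.
   [st] lists the calls in progress, innermost first. [log (ch, F)] means that
   the execution creates the edge [F] in the subdivision of the head of [ch], the
   chain of nested calls leading to it being [ch]. An edge that has disappeared
   from the mesh by the time the for-loop reaches it is skipped. *)
Definition call_log := set (seq (edge R d) * edge R d).

Inductive refine (p : nat) :
    seq (edge R d) -> mesh M0 -> edge R d -> mesh M0 -> call_log -> Prop :=
  | Refine st M E M1 log :
      while_pending p (E :: st) M E M1 log ->
      refine p st M E (subdiv M1 E)
        (log `|` [set x | x.1 = E :: st /\
                          (edges (subdiv M1 E) `\` edges M1) x.2])
with while_pending (p : nat) :
    seq (edge R d) -> mesh M0 -> edge R d -> mesh M0 -> call_log -> Prop :=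
  | While_exit st M E :
      pending p M E = set0 -> while_pending p st M E M set0
  | While_iter st M E (s : seq (edge R d)) M1 log1 M2 log2 :
      pending p M E !=set0 ->
      uniq s -> [set` s] = pending p M E ->
      refine_all p st M s M1 log1 ->
      while_pending p st M1 E M2 log2 ->
      while_pending p st M E M2 (log1 `|` log2)
with refine_all (p : nat) :
    seq (edge R d) -> mesh M0 -> seq (edge R d) -> mesh M0 -> call_log -> Prop :=
  | All_nil st M : refine_all p st M [::] M set0
  | All_skip st M F s M1 log :
      ~ edges M F ->
      refine_all p st M s M1 log -> refine_all p st M (F :: s) M1 log
  | All_call st M F s M1 log1 M2 log2 :
      edges M F ->
      refine p st M F M1 log1 -> refine_all p st M1 s M2 log2 ->
      refine_all p st M (F :: s) M2 (log1 `|` log2).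

Inductive generated (p : nat) : mesh M0 -> Prop :=
  | Gen_initial : generated p mesh0
  | Gen_refine M E M' log :
      generated p M -> edges M E -> refine p [::] M E M' log ->
      generated p M'.

End Refinement.

(* [ch] lists the edges [E_0, ..., E_J] of a chain of calls. *)
Definition num_directions (R : realType) (d : nat) (ch : seq (edge R d)) : nat :=
  size (undup (map (@di R d) ch)).

Definition refine_const (R : realType) (K p : nat) : R :=
  2^-1 + 2 / (2 `^ (K%:R^-1) * (2 `^ (K%:R^-1) - 1)) * p.+1%:R.

(* Main.v *)
Require Import Defs.
From mathcomp Require Import all_boot all_order all_algebra.
From mathcomp Require Import all_classical all_reals all_analysis.
From mathcomp Require Import ring lra zify.

Set Implicit Arguments.
Unset Strict Implicit.
Unset Printing Implicit Defensive.

Import Order.TTheory GRing.Theory Num.Theory.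

Local Open Scope classical_set_scope.
Local Open Scope ring_scope.

(** The mesh metric is a path metric: [dist A B <= r] holds when [A] and [B] are
    joined by [n] cells of the [j]-th uniform refinement with [n / 2 ^ j <= r]. The
    level [j] does not matter, because a path can be refined by splitting each cell
    and coarsened by halving its length ([reach_refine], [reach_coarsen]); hence the
    triangle inequality [near_trans] and the criterion [distP].

    Every execution of REFINE passes only through meshes obtained by subdividing an
    edge [E] no neighbor of which precedes it. Such meshes stay graded
    ([subdiv_graded]): each element has sides of lengths [2 ^- h] and [2 ^- v] with
    [h] and [v] differing by at most one, and at least one of two opposite sides is
    an unbroken edge. The reason is that, when an element is bisected across [E], one
    of its sides adjacent to [E] is in the mesh; this side is within distance
    [2 ^- level E] of [E] if it has a lower level, and the end of the loop of REFINE
    excludes such neighbors ([split_level]). Consequently a new edge [F] is at most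
    one level finer than the subdivided edge and its midpoint is half of its own
    length away ([new_edge]).

    For a chain [E_J, ..., E_0] of calls the triangle inequality bounds the distance
    of [E_J] and [E_0] by [(p + 1) / 2] times the sum of [2 ^- level E_j] over
    [j = 1, ..., J]. Let [K] be the number of direction indices in the chain and let
    the height of an edge be [K] times its level plus the rank of its direction index
    among these [K] numbers. Heights increase strictly with [j], so that
    [level E_j - level E_0 >= (j - (K - 1)) / K], and the sum is less than a geometric
    series with ratio [2 ^ (- 1 / K)] ([chain_near]). Its value gives the constant
    [C]; the bound [C < 5 K (p + 1)] follows from [2 ^ (1 / K) - 1 >= 1 / (2 K)]
    ([root2_lower]). *)

(** * Affine segments in the plane *)

Section Affine.
Variable R : realType.
Implicit Types (a b c d u v : R * R) (s t : R).

Lemma affine0 a b : affine a b 0 = a.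
Proof. by case: a => a1 a2; rewrite /affine /=; congr (_, _); ring. Qed.

Lemma affine1 a b : affine a b 1 = b.
Proof. by case: b => b1 b2; rewrite /affine /=; congr (_, _); ring. Qed.

Lemma affineC a b t : affine a b t = affine b a (1 - t).
Proof. by rewrite /affine /=; congr (_, _); ring. Qed.

Lemma midptC a b : midpt a b = midpt b a.
Proof. by rewrite /midpt affineC; congr affine; field. Qed.

Lemma affine_affine a b s t r :
  affine (affine a b s) (affine a b t) r = affine a b ((1 - r) * s + r * t).
Proof. by rewrite /affine /=; congr (_, _); ring. Qed.

Lemma affine_midpt a b t : affine a (midpt a b) t = affine a b (t / 2).
Proof. by rewrite /midpt /affine /=; congr (_, _); field. Qed.

Lemma affine_closed a b t : closed_square a -> closed_square b ->
  0 <= t <= 1 -> closed_square (affine a b t).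
Proof.
move=> [a1 a2] [b1 b2] t01; rewrite /closed_square /affine /=.
by split; nra.
Qed.

Lemma affine_inj a b : a <> b -> injective (affine a b).
Proof.
case: a b => [a1 a2] [b1 b2] ab s t [] /= e1 e2.
have {}e1 : (s - t) * (b1 - a1) = 0 by lra.
have {}e2 : (s - t) * (b2 - a2) = 0 by lra.
apply/eqP; rewrite -subr_eq0; apply/negPn/negP => st.
move/eqP: e1; move/eqP: e2; rewrite !mulf_eq0 (negPf st) /= !subr_eq0.
by move=> /eqP e2 /eqP e1; apply: ab; rewrite e1 e2.
Qed.

(** The ends of a segment are recovered by extrapolation from two interior points,
    the only ones that an open segment provides. *)
Lemma affine_on_line a b c d s t :
  affine a b 3^-1 = affine c d s -> affine a b (2 / 3) = affine c d t ->
  a = affine c d (2 * s - t) /\ b = affine c d (2 * t - s).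
Proof.
case: a b c d => [a1 a2] [b1 b2] [c1 c2] [d1 d2] [e1 e2] [e3 e4].
by split; congr (_, _) => /=; lra.
Qed.

Lemma interval_ends (u w : R) :
  (forall t, 0 < t < 1 <-> exists2 s, 0 < s < 1 & t = (1 - s) * u + s * w) ->
  (u = 0 /\ w = 1) \/ (u = 1 /\ w = 0).
Proof.
wlog uw : u w / u <= w => [hw h|h].
  have [/hw/(_ h)//|/ltW wu] := leP u w.
  have [|[-> ->]|[-> ->]] := hw w u wu; [|by right|by left].
  move=> t; rewrite h; split=> -[s s01 ->]; exists (1 - s); try lra; ring.
left.
have uw' : u < w.
  rewrite lt_neqAle uw andbT; apply/eqP => e; subst w.
  have /h[s _ e1] : 0 < (1 / 2 : R) < 1 by lra.
  have /h[s' _ e2] : 0 < (1 / 3 : R) < 1 by lra.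
  lra.
have {}h t : (0 < t < 1) = (u < t < w).
  apply/idP/idP => [/h [s s01 ->]|tuw]; first by nra.
  apply/h; exists ((t - u) / (w - u)); last by field; lra.
  rewrite divr_gt0 ?subr_gt0; [|lra..].
  by rewrite ltr_pdivrMr ?subr_gt0 //; lra.
split; apply/eqP; rewrite eq_le; apply/andP; split; rewrite leNgt; apply/negP => hl.
(* Each strict inequality between the ends leaves room for a point, the middle of
   the gap, that lies in just one of the two intervals. *)
- have : 0 < Num.min u 1 / 2 < 1 by case: (leP u 1); lra.
  by rewrite h; case: (leP u 1); lra.
- have : u < (u + Num.min 0 w) / 2 < w by case: (leP 0 w); lra.
  by rewrite -h; case: (leP 0 w); lra.
- have : u < (w + Num.max u 1) / 2 < w by case: (leP u 1); lra.
  by rewrite -h; case: (leP u 1); lra.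
- have : 0 < (1 + Num.max 0 w) / 2 < 1 by case: (leP 0 w); lra.
  by rewrite h; case: (leP 0 w); lra.
Qed.

(** Since [c] and [d] lie on the line through [a] and [b], the claim reduces to one
    about intervals of parameters. *)
Lemma open_segment_ends a b c d : a <> b ->
  (forall x, (exists2 t, 0 < t < 1 & x = affine a b t) <->
             (exists2 t, 0 < t < 1 & x = affine c d t)) ->
  (c = a /\ d = b) \/ (c = b /\ d = a).
Proof.
move=> ab h.
have [s _ e1] : exists2 s, 0 < s < 1 & affine c d 3^-1 = affine a b s.
  by apply/h; exists 3^-1 => //; lra.
have [t _ e2] : exists2 s, 0 < s < 1 & affine c d (2 / 3) = affine a b s.
  by apply/h; exists (2 / 3) => //; lra.
have [ec ed] := affine_on_line e1 e2.
move: (2 * s - t) (2 * t - s) ec ed => u w ec ed; subst c d.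
have [|[-> ->]|[-> ->]] := interval_ends (u := u) (w := w); rewrite ?affine0 ?affine1; auto.
move=> r; split=> [r01|[s' s01 e]].
  have /h[s' s01] : exists2 t, 0 < t < 1 & affine a b r = affine a b t by exists r.
  by rewrite affine_affine => /(affine_inj ab) e; exists s'.
have /h[s'' s01'] : exists2 t, 0 < t < 1 &
    affine a b r = affine (affine a b u) (affine a b w) t.
  by exists s' => //; rewrite affine_affine e.
by move=> /(affine_inj ab) ->.
Qed.

End Affine.

(** * Segments on the cells of the initial mesh *)

Lemma ord4P (P : 'I_4 -> Prop) :
  P 0 -> P 1 -> P 2 -> P 3 -> forall i, P i.
Proof.
move=> p0 p1 p2 p3 [[|[|[|[|//]]]] hi].
- by rewrite (_ : Ordinal hi = 0) //; apply: val_inj.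
- by rewrite (_ : Ordinal hi = 1) //; apply: val_inj.
- by rewrite (_ : Ordinal hi = 2) //; apply: val_inj.
- by rewrite (_ : Ordinal hi = 3) //; apply: val_inj.
Qed.

Section Segments.
Variables (R : realType) (d : nat) (M0 : initial_mesh R d).
Implicit Types (Q : cell M0) (a b c : R * R) (s t : R) (i : 'I_4).

Definition side_point i t : R * R :=
  affine (corner (0, 0) (1, 1) i) (corner (0, 0) (1, 1) (i + 1)) t.

Lemma side_pointE t :
  [/\ side_point 0 t = (t, 0), side_point 1 t = (1, t),
      side_point 2 t = (1 - t, 1) & side_point 3 t = (0, 1 - t)].
Proof. by split; rewrite /side_point /affine /corner /=; congr (_, _); ring. Qed.

Lemma corner_closed i : @closed_square R (corner (0, 0) (1, 1) i).
Proof. by move: i; apply: ord4P; rewrite /closed_square /corner /=; split; lra. Qed.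

Lemma side_point_closed i t : 0 <= t <= 1 -> closed_square (side_point i t).
Proof. by apply: affine_closed; exact: corner_closed. Qed.

Lemma side_point_inside i t : closed_square (side_point i t) -> 0 <= t <= 1.
Proof.
have [e0 e1 e2 e3] := side_pointE t.
by move: i; apply: ord4P; rewrite ?e0 ?e1 ?e2 ?e3 /closed_square /=; lra.
Qed.

Lemma corner_neq i :
  corner (0, 0) (1, 1) i <> corner (0, 0) (1, 1) (i + 1) :> R * R.
Proof.
by move: i; apply: ord4P; rewrite /corner /= => -[]; lra.
Qed.

(** Regularity of the initial mesh makes two cells meet in a corner or along a side,
    and injectivity of the parametrizations carries this over to the parameters. In
    both cases all common points are described, not only the given one; so a segment
    with two common points excludes the first case. *)
Lemma cells_meet Q Q' u u' : Q != Q' -> closed_square u -> closed_square u' ->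
  par Q u = par Q' u' ->
  (exists i k, [/\ u = corner (0, 0) (1, 1) i, u' = corner (0, 0) (1, 1) k &
     forall x x', closed_square x -> closed_square x' ->
       par Q x = par Q' x' -> x = corner (0, 0) (1, 1) i]) \/
  (exists i k, (exists2 t, 0 <= t <= 1 &
      u = side_point i t /\ u' = side_point k (1 - t)) /\
     (forall x x', closed_square x -> closed_square x' ->
       par Q x = par Q' x' -> exists2 t, 0 <= t <= 1 & x = side_point i t) /\
     (forall s, 0 <= s <= 1 ->
        par Q (side_point i s) = par Q' (side_point k (1 - s)))).
Proof.
move=> QQ' cu cu' e; have /= := mesh_regular QQ'.
set sh := _ `&` _ => H.
have shP x x' : closed_square x -> closed_square x' ->
    par Q x = par Q' x' -> sh (par Q x).
  by move=> cx cx' ex; split; [exists x|exists x'].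
have shu := shP _ _ cu cu' e.
case: H => [h0|[i [k [h1 h2]]]|[i [k [h1 h2]]]].
- by move: shu; rewrite h0.
- right; exists i, k.
  have on_side x x' : closed_square x -> closed_square x' ->
       par Q x = par Q' x' -> exists2 t, 0 <= t <= 1 & x = side_point i t.
    move=> cx cx' ex; have := shP _ _ cx cx' ex; rewrite h1 => -[t t01 et].
    exists t => //; symmetry; apply: (par_inj _ cx et).
    exact: side_point_closed.
  split; last by split.
  have [t t01 ut] := on_side _ _ cu cu' e; exists t => //; split => //.
  apply: (@par_inj _ _ _ Q') => //; first by apply: side_point_closed; lra.
  by apply: etrans (esym e) _; rewrite ut; apply: h2.
- left; exists i, k; move: h1 h2; rewrite !affine0 => h1 h2.
  have at_corner x x' : closed_square x -> closed_square x' ->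
       par Q x = par Q' x' -> x = corner (0, 0) (1, 1) i.
    move=> cx cx' ex; have := shP _ _ cx cx' ex; rewrite h1 => et.
    by apply: (par_inj cx _ et); exact: corner_closed.
  split=> //; first exact: at_corner cu cu' e.
  apply: (par_inj cu' (corner_closed k)).
  by apply: etrans (esym e) _; rewrite (at_corner _ _ cu cu' e).
Qed.

Lemma segC Q a b : seg Q a b = seg Q b a.
Proof.
apply/seteqP; split=> x [t]; rewrite /= in_itv /= => t01 <-;
  exists (1 - t); rewrite /= ?in_itv /= -?affineC //; lra.
Qed.

(** Such a segment lies on a common side, along which the parametrizations of [Q] and
    [Q'] differ by a reversal. *)
Lemma segment_in_neighbor Q Q' a b : Q != Q' ->
  closed_square a -> closed_square b -> a <> b ->
  (forall t, 0 < t < 1 -> exists2 u', closed_square u' &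
     par Q (affine a b t) = par Q' u') ->
  exists a' b', [/\ closed_square a', closed_square b', a' <> b' &
    forall t, 0 <= t <= 1 -> par Q (affine a b t) = par Q' (affine a' b' t)].
Proof.
move=> QQ' ca cb ab sub.
have in_closed t : 0 < t < 1 -> closed_square (affine a b t).
  by move=> t01; apply: affine_closed => //; lra.
have t13 : 0 < 3^-1 :> R /\ 3^-1 < 1 :> R by lra.
have t23 : 0 < 2 / 3 :> R /\ 2 / 3 < 1 :> R by lra.
have [u1 cu1 e1] := sub _ (introT andP t13).
have [u2 cu2 e2] := sub _ (introT andP t23).
have c1 := in_closed _ (introT andP t13).
have c2 := in_closed _ (introT andP t23).
have [[i [k [_ _ one]]]|[i [k [_ [on_side glue]]]]] := cells_meet QQ' c1 cu1 e1.
  have := one _ _ c2 cu2 e2; rewrite -(one _ _ c1 cu1 e1) => /(affine_inj ab).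
  lra.
have [s _ es] := on_side _ _ c1 cu1 e1.
have [r _ er] := on_side _ _ c2 cu2 e2.
have [ea eb] := affine_on_line es er; rewrite -!/(side_point i _) in ea eb.
move: (2 * s - r) (2 * r - s) ea eb => al be ea eb.
have al01 : 0 <= al <= 1 by apply: (@side_point_inside i); rewrite -ea.
have be01 : 0 <= be <= 1 by apply: (@side_point_inside i); rewrite -eb.
exists (side_point k (1 - al)), (side_point k (1 - be)); split.
- by apply: side_point_closed; lra.
- by apply: side_point_closed; lra.
- by move=> /(affine_inj (@corner_neq k)) e; apply: ab; rewrite ea eb; congr side_point; lra.
- move=> t t01; rewrite ea eb /side_point !affine_affine -!/(side_point _ _).
  rewrite glue; last by nra.
  by congr (par _ (side_point _ _)); ring.
Qed.

(** Midpoints and children of an edge are defined through arbitrary representations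
    of it as a segment; this makes them computable from a single one. *)
Lemma seg_param Q Q' a b a' b' :
  closed_square a -> closed_square b -> a <> b ->
  closed_square a' -> closed_square b' -> seg Q a b = seg Q' a' b' ->
  (forall t, 0 <= t <= 1 -> par Q (affine a b t) = par Q' (affine a' b' t)) \/
  (forall t, 0 <= t <= 1 -> par Q (affine a b t) = par Q' (affine b' a' t)).
Proof.
move=> ca cb ab ca' cb' e.
have [a'' [b'' [ca'' cb'' ab'' e'']]] :
    exists a'' b'', [/\ closed_square a'', closed_square b'', a'' <> b'' &
    forall t, 0 <= t <= 1 -> par Q (affine a b t) = par Q' (affine a'' b'' t)].
  have [eQ|/eqP QQ'] := pselect (Q = Q'); first by subst Q'; exists a, b.
  apply: segment_in_neighbor => // t t01.
  have : seg Q a b (par Q (affine a b t)) by exists t => //=; rewrite in_itv.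
  rewrite e => -[s]; rewrite /= in_itv /= => s01 <-.
  by exists (affine a' b' s) => //; apply: affine_closed => //; lra.
have same : seg Q' a'' b'' = seg Q' a' b'.
  rewrite -e; apply/seteqP; split=> x [t]; rewrite /= in_itv /= => t01 <-;
    by exists t; rewrite /= ?in_itv //= e'' //; lra.
have [|[? ?]|[? ?]] := open_segment_ends (c := a') (d := b') ab''.
- move=> x; split=> -[t t01 ->].
  + have : seg Q' a'' b'' (par Q' (affine a'' b'' t)) by exists t => //=; rewrite in_itv.
    rewrite same => -[s]; rewrite /= in_itv /= => s01 es; exists s => //.
    by symmetry; apply: (par_inj _ _ es); apply: affine_closed => //; lra.
  + have : seg Q' a' b' (par Q' (affine a' b' t)) by exists t => //=; rewrite in_itv.
    rewrite -same => -[s]; rewrite /= in_itv /= => s01 es; exists s => //.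
    by symmetry; apply: (par_inj _ _ es); apply: affine_closed => //; lra.
- by subst a'' b''; left.
- by subst a'' b''; right.
Qed.

Lemma midE (E : edge R d) Q a b :
  closed_square a -> closed_square b -> a <> b -> locus E = seg Q a b ->
  mid M0 E = par Q (midpt a b).
Proof.
move=> ca cb ab eE; rewrite /mid; case: xgetP => [m -> |].
  move=> [Q' [a' [b' [ca' cb' e ->]]]].
  rewrite eE in e; have [h|h] := seg_param ca cb ab ca' cb' e.
    by rewrite /midpt h //; lra.
  by rewrite (midptC a') /midpt h //; lra.
by move=> /(_ (par Q (midpt a b))) []; exists Q, a, b.
Qed.

Lemma childrenE (E F : edge R d) Q a b :
  closed_square a -> closed_square b -> a <> b -> locus E = seg Q a b ->
  children M0 E F <->
  F = Edge (seg Q a (midpt a b)) (level E).+1 (di E) \/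
  F = Edge (seg Q b (midpt a b)) (level E).+1 (di E).
Proof.
move=> ca cb ab eE; split; last first.
  move=> [] ->; [exists Q, a, b|exists Q, b, a] => //.
  by rewrite segC midptC.
move=> [Q' [a' [b' [ca' cb' e ->]]]].
have half c c' e' e'' :
   (forall t, 0 <= t <= 1 -> par Q (affine c c' t) = par Q' (affine e' e'' t)) ->
   seg Q c (midpt c c') = seg Q' e' (midpt e' e'').
  move=> h; apply/seteqP; split=> x [t]; rewrite /= in_itv /= => t01 <-;
    by exists t; rewrite /= ?in_itv //= !affine_midpt h //; lra.
rewrite eE in e; have [h|h] := seg_param ca cb ab ca' cb' e.
  by left; rewrite (half _ _ _ _ h).
right; rewrite [midpt a b]midptC; rewrite (half b a a' b') // => t t01.
by rewrite affineC h ?[affine a' _ _]affineC //; lra.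
Qed.

End Segments.

(** * The uniform grids and their path lengths *)

Section GridPoints.
Variables (R : realType) (d : nat) (M0 : initial_mesh R d).
Implicit Types (Q : cell M0) (z w : nat * nat) (i : 'I_4) (A B V : 'rV[R]_d).

Definition grid_coord (j : nat) z : R * R :=
  (z.1%:R / 2 ^+ j, z.2%:R / 2 ^+ j).

Definition grid_point (j : nat) Q z : 'rV[R]_d := par Q (grid_coord j z).

Definition in_grid (N : nat) z := (z.1 <= N)%N && (z.2 <= N)%N.

Lemma pow2_gt0 j : 0 < (2 : R) ^+ j.
Proof. exact: exprn_gt0. Qed.

Lemma grid_fraction_le1 j n : (n <= 2 ^ j)%N -> 0 <= n%:R / (2 : R) ^+ j <= 1.
Proof.
move=> nj; apply/andP; split; first by rewrite divr_ge0 ?ler0n // exprn_ge0.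
by rewrite ler_pdivrMr ?pow2_gt0 // mul1r -natrX ler_nat.
Qed.

Lemma grid_coord_closed j z : in_grid (2 ^ j) z -> closed_square (grid_coord j z).
Proof. by move=> /andP[z1 z2]; split; apply: grid_fraction_le1. Qed.

Lemma grid_coord_inj j : injective (grid_coord j).
Proof.
have p : (2 : R) ^+ j != 0 by rewrite lt0r_neq0 ?pow2_gt0.
move=> [x y] [x' y'] [] /(mulIf (invr_neq0 p))/eqP + /(mulIf (invr_neq0 p))/eqP.
by rewrite !eqr_nat => /eqP -> /eqP ->.
Qed.

Lemma grid_coord_double j z :
  grid_coord j.+1 (z.1.*2, z.2.*2) = grid_coord j z.
Proof.
have p : (2 : R) ^+ j != 0 by rewrite lt0r_neq0 ?pow2_gt0.
by rewrite /grid_coord /= -!muln2 !natrM exprS; congr (_, _); field.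
Qed.

(** The [k]-th of the [N + 1] equally spaced grid points on side [i]. *)
Definition side_grid (N : nat) i (k : nat) : nat * nat :=
  nth (0, 0)%N [:: (k, 0); (N, k); (N - k, N); (0, N - k)]%N i.

Lemma side_gridE j i k : (k <= 2 ^ j)%N ->
  grid_coord j (side_grid (2 ^ j) i k) = side_point i (k%:R / 2 ^+ j).
Proof.
move=> kj; have [e0 e1 e2 e3] := side_pointE (k%:R / (2 : R) ^+ j).
have p : (2 : R) ^+ j != 0 by rewrite lt0r_neq0 ?pow2_gt0.
move: i; apply: ord4P; rewrite ?e0 ?e1 ?e2 ?e3 /grid_coord /side_grid /=;
  rewrite ?mul0r ?natrB // ?natrX; congr (_, _); field => //.
Qed.

Lemma side_grid_inv j i z t : in_grid (2 ^ j) z -> 0 <= t <= 1 ->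
  grid_coord j z = side_point i t ->
  exists2 k, (k <= 2 ^ j)%N & t = k%:R / 2 ^+ j /\ z = side_grid (2 ^ j) i k.
Proof.
move=> zg t01 e.
have p := pow2_gt0 j.
have [e0 e1 e2 e3] := side_pointE t.
suff [k [kj tk]] : exists k, (k <= 2 ^ j)%N /\ t = k%:R / 2 ^+ j.
  exists k => //; split=> //; apply: (@grid_coord_inj j).
  by rewrite e tk side_gridE.
move: zg => /andP[z1 z2].
have coord n (s : R) : n%:R / 2 ^+ j = 1 - s -> (n <= 2 ^ j)%N ->
    s = (2 ^ j - n)%:R / 2 ^+ j.
  move=> h nj; rewrite natrB // natrX mulrBl h divff ?lt0r_neq0 //; ring.
move: i e; apply: ord4P; rewrite ?e0 ?e1 ?e2 ?e3 => -[/= h1 h2].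
- by exists z.1.
- by exists z.2.
- by exists (2 ^ j - z.1)%N; split; [exact: leq_subr|exact: coord].
- by exists (2 ^ j - z.2)%N; split; [exact: leq_subr|exact: coord].
Qed.

(** The description of the common points of two cells holds on all grids at once,
    which allows a comparison of the grids [j] and [j + 1]. *)
Lemma grid_points_meet j Q Q' z z' : Q != Q' ->
  in_grid (2 ^ j) z -> in_grid (2 ^ j) z' ->
  grid_point j Q z = grid_point j Q' z' ->
  (exists i k, z = side_grid (2 ^ j) i 0 /\ z' = side_grid (2 ^ j) k 0) \/
  (exists i k c, [/\ (c <= 2 ^ j)%N, z = side_grid (2 ^ j) i c,
     z' = side_grid (2 ^ j) k (2 ^ j - c) &
     forall n m, (m <= 2 ^ n)%N -> grid_point n Q (side_grid (2 ^ n) i m) =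
                                   grid_point n Q' (side_grid (2 ^ n) k (2 ^ n - m))]).
Proof.
move=> QQ' zg zg' e.
have p := pow2_gt0 j.
have [[i [k [e1 e2 _]]]|[i [k [[t t01 [e1 e2]] [_ glue]]]]] :=
  cells_meet QQ' (grid_coord_closed zg) (grid_coord_closed zg') e.
- left; exists i, k.
  have zero z1 k1 : grid_coord j z1 = corner (0, 0) (1, 1) k1 ->
      z1 = side_grid (2 ^ j) k1 0.
    move=> e3; apply: (@grid_coord_inj j).
    by rewrite e3 side_gridE // mul0r /side_point affine0.
  by split; exact: zero.
- right; have [c cj [tc zc]] := side_grid_inv zg t01 e1.
  exists i, k, c; split=> //.
    apply: (@grid_coord_inj j); rewrite e2 side_gridE ?leq_subr //.
    by rewrite tc natrB // natrX mulrBl divff ?lt0r_neq0.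
  move=> n m mn; have pn := pow2_gt0 n.
  rewrite /grid_point !side_gridE ?leq_subr // natrB // natrX mulrBl divff ?lt0r_neq0 //.
  by apply: glue; apply: grid_fraction_le1.
Qed.

(** For [0 < N] this says that [z] and [w] are vertices of a common cell of the grid
    [{0, ..., N}^2]. *)
Definition grid_adj (N : nat) z w : bool :=
  [&& in_grid N z, in_grid N w, (z.1 <= w.1.+1)%N, (w.1 <= z.1.+1)%N,
      (z.2 <= w.2.+1)%N & (w.2 <= z.2.+1)%N].

Definition grid_step (j : nat) A V : Prop :=
  exists Q z w, [/\ grid_adj (2 ^ j) z w, A = grid_point j Q z &
                    V = grid_point j Q w].

Fixpoint reach (j n : nat) A B : Prop :=
  if n is n'.+1 then exists2 V, grid_step j A V & reach j n' V B else A = B.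

Definition is_node (j : nat) A : Prop :=
  exists Q z, in_grid (2 ^ j) z /\ A = grid_point j Q z.

Lemma reach_cat j m n A V B :
  reach j m A V -> reach j n V B -> reach j (m + n) A B.
Proof.
elim: m A => [A -> //|m IH A [W s r] r' /=].
by exists W => //; apply: IH.
Qed.

Lemma is_nodeS j A : is_node j A -> is_node j.+1 A.
Proof.
move=> [Q [z [zg ->]]]; exists Q, (z.1.*2, z.2.*2).
rewrite /grid_point grid_coord_double; split=> //.
by move: zg; rewrite /in_grid /= expnS; lia.
Qed.

(** The middle of two vertices of a cell is a node of the next grid, and on either
    side of it the way from one to the other stays in one cell of that grid. *)
Lemma reach_refine j n A B : reach j n A B -> reach j.+1 n.*2 A B.
Proof.
elim: n A => [//|n IH] A [V [Q [z [w [zw -> ->]]]] r].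
rewrite doubleS; exists (grid_point j.+1 Q (z.1 + w.1, z.2 + w.2)%N).
  exists Q, (z.1.*2, z.2.*2), (z.1 + w.1, z.2 + w.2)%N.
  split=> //; last by rewrite /grid_point grid_coord_double.
  by move: zw; rewrite /grid_adj /in_grid /= expnS; lia.
exists (grid_point j Q w); last exact: IH.
exists Q, (z.1 + w.1, z.2 + w.2)%N, (w.1.*2, w.2.*2).
split=> //; last by rewrite /grid_point grid_coord_double.
by move: zw; rewrite /grid_adj /in_grid /= expnS; lia.
Qed.

Lemma reach_in_cell j n Q z w : in_grid (2 ^ j) z -> in_grid (2 ^ j) w ->
  (z.1 <= w.1 + n)%N -> (w.1 <= z.1 + n)%N ->
  (z.2 <= w.2 + n)%N -> (w.2 <= z.2 + n)%N ->
  reach j n (grid_point j Q z) (grid_point j Q w).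
Proof.
move=> + wg; elim: n z => [|n IH] z zg h1 h2 h3 h4 /=.
  congr grid_point; case: z w {zg wg} h1 h2 h3 h4 => [z1 z2] [w1 w2] /=.
  by move=> *; congr (_, _); lia.
(* one step towards [w] in each coordinate, like a king on a chessboard *)
pose toward (x y : nat) := if (x < y)%N then x.+1 else if (y < x)%N then x.-1 else x.
exists (grid_point j Q (toward z.1 w.1, toward z.2 w.2)).
  exists Q, z, (toward z.1 w.1, toward z.2 w.2); split=> //.
  by move: zg wg; rewrite /grid_adj /in_grid /toward /=; do !case: ifP; lia.
by apply: IH; move: zg wg; rewrite /in_grid /toward /=; do ?case: ifP; lia.
Qed.

(** What [n] steps on grid [j + 1] from the point [z] of that grid to a node [B]
    of grid [j] yield on grid [j]. If [z] lies on an edge of grid [j] (possibly at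
    an end point), the distances of [B] from the two ends of this edge add up to
    at most [n]; if [z] is the centre of a cell, some corner of this cell is at
    distance at most [(n - 1) / 2]. *)
Definition half_reach j B Q z n : Prop :=
  if odd z.1 && odd z.2 then
    exists w m, [/\ (w.1 = z.1./2 \/ w.1 = uphalf z.1),
                    (w.2 = z.2./2 \/ w.2 = uphalf z.2),
                    reach j m (grid_point j Q w) B & (m.*2 < n)%N]
  else
    exists m1 m2, [/\ reach j m1 (grid_point j Q (z.1./2, z.2./2)) B,
                      reach j m2 (grid_point j Q (uphalf z.1, uphalf z.2)) B &
                      (m1 + m2 <= n)%N].

(** All points involved lie in one cell of grid [j], so each distance changes by at
    most one. In a step from edge to edge the two edges of grid [j] share an end, so
    that only one of the two distances changes. *)
Lemma half_reach_step j B Q z z' n : grid_adj (2 ^ j.+1) z z' ->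
  half_reach j B Q z' n -> half_reach j B Q z n.+1.
Proof.
rewrite /half_reach => zz'.
have step w w' m : grid_adj (2 ^ j) w w' ->
    reach j m (grid_point j Q w') B -> reach j m.+1 (grid_point j Q w) B.
  by move=> ww' r; exists (grid_point j Q w') => //; exists Q, w, w'.
have even_grid x : (x <= 2 ^ j.+1)%N -> (uphalf x <= 2 ^ j)%N by rewrite expnS; lia.
have adjP x1 x2 y1 y2 :
   ((x1 = z.1./2) \/ (x1 = uphalf z.1)) -> ((x2 = z.2./2) \/ (x2 = uphalf z.2)) ->
   ((y1 = z'.1./2) \/ (y1 = uphalf z'.1)) -> ((y2 = z'.2./2) \/ (y2 = uphalf z'.2)) ->
   grid_adj (2 ^ j) (x1, x2) (y1, y2).
  move: zz'; rewrite /grid_adj /in_grid /=.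
  move=> /and5P[/andP[a1 a2] /andP[a3 a4] b1 b2 /andP[b3 b4]].
  move: (even_grid _ a1) (even_grid _ a2) (even_grid _ a3) (even_grid _ a4); lia.
case: ifP => zo'.
(* from the centre of a cell of grid [j] *)
- move=> [[w1 w2] [m [/= h1 h2 r mn]]]; case: ifP => zo.
    exists (w1, w2), m; split=> //=; last by lia.
    + have : z.1 = z'.1 by move: zz' zo zo'; rewrite /grid_adj /in_grid /=; lia.
      by move=> ->.
    + have : z.2 = z'.2 by move: zz' zo zo'; rewrite /grid_adj /in_grid /=; lia.
      by move=> ->.
  exists m.+1, m.+1; split; [| |lia]; apply: (step _ (w1, w2)) => //;
    apply: adjP; auto.
- move=> [m1 [m2 [r1 r2 mn]]]; case: ifP => zo.
  (* to the centre of a cell: take the end of the edge that is closer to [B] *)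
  + have [m12|m21] := leqP m1 m2.
      exists (z'.1./2, z'.2./2), m1; split=> //=; last by lia.
      * by move: zz' zo zo'; rewrite /grid_adj /in_grid /=; lia.
      * by move: zz' zo zo'; rewrite /grid_adj /in_grid /=; lia.
    exists (uphalf z'.1, uphalf z'.2), m2; split=> //=; last by lia.
      * by move: zz' zo zo'; rewrite /grid_adj /in_grid /=; lia.
      * by move: zz' zo zo'; rewrite /grid_adj /in_grid /=; lia.
  (* from edge to edge: both edges end at the same corner *)
  + have [e|e|e|e] : [\/ ((z.1./2, z.2./2) = (z'.1./2, z'.2./2)),
      ((z.1./2, z.2./2) = (uphalf z'.1, uphalf z'.2)),
      ((uphalf z.1, uphalf z.2) = (z'.1./2, z'.2./2)) |
      ((uphalf z.1, uphalf z.2) = (uphalf z'.1, uphalf z'.2))].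
    * move: zz' zo zo'; rewrite /grid_adj /in_grid.
      case: z z' {even_grid adjP r1 r2} => [x y] [x' y'] /= *.
      suff: (x./2 = x'./2 /\ y./2 = y'./2) \/
            (x./2 = uphalf x' /\ y./2 = uphalf y') \/
            (uphalf x = x'./2 /\ uphalf y = y'./2) \/
            (uphalf x = uphalf x' /\ uphalf y = uphalf y').
        move=> [[-> ->]|[[-> ->]|[[-> ->]|[-> ->]]]];
          by [constructor 1|constructor 2|constructor 3|constructor 4].
      lia.
    * exists m1, m2.+1; rewrite e; split=> //; last by lia.
      by apply: step r2; apply: adjP; auto.
    * exists m2, m1.+1; rewrite e; split=> //; last by lia.
      by apply: step r1; apply: adjP; auto.
    * exists m2.+1, m1; rewrite e; split=> //; last by lia.
      by apply: step r2; apply: adjP; auto.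
    * exists m1.+1, m2; rewrite e; split=> //.
      by apply: step r1; apply: adjP; auto.
Qed.

Lemma half_reach_side j B Q i c n : (c <= 2 ^ j.+1)%N ->
  half_reach j B Q (side_grid (2 ^ j.+1) i c) n <->
  exists m1 m2, [/\ reach j m1 (grid_point j Q (side_grid (2 ^ j) i c./2)) B,
                    reach j m2 (grid_point j Q (side_grid (2 ^ j) i (uphalf c))) B &
                    (m1 + m2 <= n)%N].
Proof.
rewrite expnS mul2n => cj; rewrite /half_reach.
have swap (P1 P2 : nat -> Prop) :
    (exists m1 m2, [/\ P1 m1, P2 m2 & (m1 + m2 <= n)%N]) <->
    (exists m1 m2, [/\ P2 m1, P1 m2 & (m1 + m2 <= n)%N]).
  by split=> -[m1 [m2 [? ? ?]]]; exists m2, m1; rewrite addnC.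
have N1 : (2 ^ j).*2./2 = (2 ^ j)%N by lia.
have N2 : uphalf (2 ^ j).*2 = (2 ^ j)%N by lia.
have h1 : ((2 ^ j).*2 - c)./2 = (2 ^ j - uphalf c)%N by lia.
have h2 : uphalf ((2 ^ j).*2 - c) = (2 ^ j - c./2)%N by lia.
move: i; apply: ord4P; rewrite /side_grid /= ?odd_double ?andbF ?N1 ?N2 ?h1 ?h2 //.
Qed.

(** A common side carries the same subdivision points in both cells, so the ends of
    the edge of grid [j] through a point of it are the same. *)
Lemma half_reach_cell j B Q Q' z z' n :
  in_grid (2 ^ j.+1) z -> in_grid (2 ^ j.+1) z' ->
  grid_point j.+1 Q z = grid_point j.+1 Q' z' ->
  half_reach j B Q z n -> half_reach j B Q' z' n.
Proof.
move=> zg zg' e; have [eQ|/eqP QQ'] := pselect (Q = Q').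
  subst Q'; suff -> : z = z' by [].
  apply: (@grid_coord_inj j.+1).
  exact: par_inj (grid_coord_closed zg) (grid_coord_closed zg') e.
have [[i [k [? ?]]]|[i [k [c [cj ? ? glue]]]]] := grid_points_meet QQ' zg zg' e.
  subst z z'; rewrite !half_reach_side //= => -[m1 [m2 [r1 r2 mn]]].
  have corner0 j1 Q1 k1 : grid_point j1 Q1 (side_grid (2 ^ j1) k1 0) =
      par Q1 (corner (0, 0) (1, 1) k1).
    by rewrite /grid_point side_gridE // mul0r /side_point affine0.
  exists m1, m2; move: r1 r2 e; rewrite !corner0 => + + <-.
  by split.
subst z z'; rewrite !half_reach_side ?leq_subr // => -[m1 [m2 [r1 r2 mn]]].
have c1 : (c./2 <= 2 ^ j)%N by move: cj; rewrite expnS; lia.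
have c2 : (uphalf c <= 2 ^ j)%N by move: cj; rewrite expnS; lia.
exists m2, m1; rewrite addnC; split=> //.
- rewrite (_ : (2 ^ j.+1 - c)./2 = 2 ^ j - uphalf c)%N; last by rewrite expnS; lia.
  by rewrite -glue.
- rewrite (_ : uphalf (2 ^ j.+1 - c) = 2 ^ j - c./2)%N; last by rewrite expnS; lia.
  by rewrite -glue.
Qed.

Lemma half_reach_node j Q z B n : in_grid (2 ^ j) z ->
  half_reach j B Q (z.1.*2, z.2.*2) n ->
  exists2 m, (m.*2 <= n)%N & reach j m (grid_point j Q z) B.
Proof.
move=> zg; rewrite /half_reach /= odd_double !uphalf_double !doubleK /=.
move=> [m1 [m2 [r1 r2 mn]]]; case: z zg r1 r2 => [x y] /= zg r1 r2.
by have [m12|m21] := leqP m1 m2; [exists m1|exists m2] => //; lia.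
Qed.

(** The finer grid does not create short cuts: [half_reach] propagates from [B]
    backwards along a path of the finer grid. *)
Lemma reach_coarsen j n A B : is_node j A -> is_node j B ->
  reach j.+1 n A B -> exists2 m, (m.*2 <= n)%N & reach j m A B.
Proof.
move=> [Q [z [zg eA]]] [P [w [wg eB]]] r.
have dg x : in_grid (2 ^ j) x -> in_grid (2 ^ j.+1) (x.1.*2, x.2.*2).
  by rewrite /in_grid /= expnS; lia.
have node_double P1 x : grid_point j P1 x = grid_point j.+1 P1 (x.1.*2, x.2.*2).
  by rewrite /grid_point grid_coord_double.
suff key V Q1 x : in_grid (2 ^ j.+1) x -> V = grid_point j.+1 Q1 x ->
    reach j.+1 n V B -> half_reach j B Q1 x n.
  rewrite eA; apply: half_reach_node => //.
  by apply: (key A) => //; [exact: dg|rewrite eA node_double].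
elim: n V Q1 x {r} => [|n IH] V Q1 x xg eV /=.
  move=> VB; apply: (@half_reach_cell _ _ P _ (w.1.*2, w.2.*2)) => //.
  - exact: dg.
  - by rewrite -node_double -eB -VB.
  rewrite /half_reach /= odd_double !uphalf_double !doubleK /=.
  by exists 0%N, 0%N; split=> //=; rewrite eB; case: (w).
move=> [W [Q2 [y [y' [yy' eV' eW]]]] r].
have [yg yg'] : in_grid (2 ^ j.+1) y /\ in_grid (2 ^ j.+1) y'.
  by move: yy' => /and3P[].
apply: (@half_reach_cell _ _ Q2 _ y) => //; first by rewrite -eV -eV'.
by apply: half_reach_step yy' _; apply: IH r.
Qed.

End GridPoints.

(** * The mesh metric *)

Section MeshDistance.
Variables (R : realType) (d : nat) (M0 : initial_mesh R d).
Implicit Types (Q : cell M0) (z w : nat * nat) (A B V : 'rV[R]_d).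
Implicit Types (q : element M0) (r s : R) (u v : R * R).

Lemma midpt_grid_coord j z w :
  midpt (grid_coord R j z) (grid_coord R j w) =
  grid_coord R j.+1 (z.1 + w.1, z.2 + w.2)%N.
Proof.
have p : (2 : R) ^+ j != 0 by rewrite lt0r_neq0 ?pow2_gt0.
by rewrite /midpt /affine /grid_coord /= !natrD exprS; congr (_, _); field.
Qed.

Lemma natr_double n : n.*2%:R = 2 * n%:R :> R.
Proof. by rewrite -muln2 natrM mulrC. Qed.

Lemma natr_succ n : n.+1%:R = n%:R + 1 :> R.
Proof. by rewrite -addn1 natrD. Qed.

Definition grid_cell (j : nat) Q z q : Prop :=
  [/\ base q = Q, lo q = grid_coord R j z & hi q = grid_coord R j (z.1.+1, z.2.+1)].

Lemma uniform_cell j q : uniform j q ->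
  exists2 z, (z.1 < 2 ^ j)%N && (z.2 < 2 ^ j)%N & grid_cell j (base q) z q.
Proof.
elim: j q => [|j IH] q /=.
  move=> [Q _ <-]; exists (0, 0)%N => //=.
  by split; rewrite /grid_coord //= expr0 !divr1.
move=> [q0 [q1 [/IH[[x y] /= /andP[hx hy] [_ el eh]]]]].
case: q0 el eh => Q l h hl vl hd vd /= -> -> {IH}.
have p : (2 : R) ^+ j != 0 by rewrite lt0r_neq0 ?pow2_gt0.
have succ := (natr_succ x, natr_succ y, natr_succ x.*2, natr_succ y.*2,
              natr_succ x.*2.+1, natr_succ y.*2.+1).
move=> [] -> [] ->; rewrite /= expnS.
- exists (x.*2, y.*2) => /=; first by lia.
  by split=> //; rewrite /grid_coord /= ?succ !natr_double exprS; congr (_, _); field.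
- exists (x.*2, y.*2.+1) => /=; first by lia.
  by split=> //; rewrite /grid_coord /= ?succ !natr_double exprS; congr (_, _); field.
- exists (x.*2.+1, y.*2) => /=; first by lia.
  by split=> //; rewrite /grid_coord /= ?succ !natr_double exprS; congr (_, _); field.
- exists (x.*2.+1, y.*2.+1) => /=; first by lia.
  by split=> //; rewrite /grid_coord /= ?succ !natr_double exprS; congr (_, _); field.
Qed.

Lemma cell_uniform j Q z : (z.1 < 2 ^ j)%N -> (z.2 < 2 ^ j)%N ->
  exists2 q, uniform j q & grid_cell j Q z q.
Proof.
elim: j z => [|j IH] [x y].
  rewrite expn0 !ltnS !leqn0 => /= /eqP -> /eqP ->.
  exists (initial_element Q); first by exists Q.
  by split; rewrite /grid_coord //= expr0 !divr1.
rewrite /= !expnS => hx hy.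
have [q0 u0 []] : exists2 q, uniform j q & grid_cell j Q (x./2, y./2) q.
  by apply: IH => /=; lia.
case: q0 u0 => Q' l h hl vl hd vd u0 /= eQ el eh.
have p : (2 : R) ^+ j != 0 by rewrite lt0r_neq0 ?pow2_gt0.
pose q1 := if odd x then Element Q' ((midpt l h).1, l.2) h hl.+1 vl hd vd
           else Element Q' l ((midpt l h).1, h.2) hl.+1 vl hd vd.
have ex : x%:R = (odd x)%:R + 2 * (x./2)%:R :> R.
  by rewrite -{1}(odd_double_half x) natrD natr_double.
have ey : y%:R = (odd y)%:R + 2 * (y./2)%:R :> R.
  by rewrite -{1}(odd_double_half y) natrD natr_double.
pose m1 := midpt (lo q1) (hi q1).
pose q2 := if odd y then Element Q' ((lo q1).1, m1.2) (hi q1) hl.+1 vl.+1 hd vd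
           else Element Q' (lo q1) ((hi q1).1, m1.2) hl.+1 vl.+1 hd vd.
exists q2.
  exists (Element Q' l h hl vl hd vd), q1; split=> //.
    by rewrite /= /q1; case: ifP => _; [right|left].
  rewrite /q2 /m1; case: ifP => _; rewrite /q1; case: ifP => _ /=; by [right|left].
rewrite /grid_cell /q2 /m1 /q1 el eh /grid_coord /=.
rewrite (natr_succ x) (natr_succ y) (natr_succ x./2) (natr_succ y./2) ex ey exprS.
by case: (odd x); case: (odd y); split=> //=; congr (_, _); field.
Qed.

Lemma grid_step_uniform j A V :
  grid_step M0 j A V <-> exists q, [/\ uniform j q, vertices q A & vertices q V].
Proof.
split=> [[Q [z [w [zw -> ->]]]]|[q [u [i _ <-] [k _ <-]]]].
(* the lower left vertex of a common cell; points on the upper or right boundary of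
   the grid are not such vertices *)
- pose c := (minn (minn z.1 w.1) (2 ^ j).-1, minn (minn z.2 w.2) (2 ^ j).-1).
  have N0 : (0 < 2 ^ j)%N by rewrite expn_gt0.
  have [||q u [eQ el eh]] := @cell_uniform j Q c; rewrite /c /=; [by lia|by lia|].
  exists q.
  have vertex (t : nat * nat) :
      (t.1 = c.1 \/ t.1 = c.1.+1) /\ (t.2 = c.2 \/ t.2 = c.2.+1) ->
      vertices q (grid_point j Q t).
    move=> vc; suff [i e] : exists i, corner (lo q) (hi q) i = grid_coord R j t.
      by exists i => //; rewrite eQ e.
    move: vc; rewrite el eh; case: (t) (c) => [x y] [x' y'] [[]/= -> [] ->].
    - by exists 0.
    - by exists 3.
    - by exists 1.
    - by exists 2.
  by split=> //; apply: vertex; move: zw; rewrite /c /grid_adj /in_grid /=; lia.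
- have [[x y] /= xy [_ el eh]] := uniform_cell u.
  have cornerE i1 : exists a b, [/\ (a <= 1)%N, (b <= 1)%N &
      corner (lo q) (hi q) i1 = grid_coord R j (x + a, y + b)%N].
    rewrite el eh; move: i1; apply: ord4P; rewrite /corner /=.
    * by exists 0%N, 0%N; rewrite !addn0.
    * by exists 1%N, 0%N; rewrite addn0 addn1.
    * by exists 1%N, 1%N; rewrite !addn1.
    * by exists 0%N, 1%N; rewrite addn0 addn1.
  have [a [b [a1 b1 ->]]] := cornerE i.
  have [a' [b' [a1' b1' ->]]] := cornerE k.
  exists (base q), (x + a, y + b)%N, (x + a', y + b')%N; split=> //.
  by move: xy; rewrite /grid_adj /in_grid /=; lia.
Qed.

Lemma joins_reach j n A B :
  (exists2 s, size s = n & joins (M0 := M0) j A s B) <-> reach M0 j n A B.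
Proof.
elim: n A => [|n IH] A /=.
  by split=> [[s /size0nil -> //]|->]; exists [::].
split=> [[[//|q s] /= [sn] [u qA [V [qV VB]]]]|[V /grid_step_uniform[q [u qA qV]]]].
- by exists V; [apply/grid_step_uniform; exists q|apply/IH; exists s].
- by move=> /IH[s sn VB]; exists (q :: s); rewrite /= ?sn //; split=> //; exists V.
Qed.

Lemma is_node_uniform j A : uniform_nodes M0 j A <-> is_node M0 j A.
Proof.
split=> [[q u qA]|[Q [z [zg ->]]]].
  have [|Q [z [w [zw eA _]]]] := (grid_step_uniform j A A).2 _; first by exists q.
  by exists Q, z; split=> //; case/and3P: zw.
have /grid_step_uniform[q [u qA _]] :
    grid_step M0 j (grid_point j Q z) (grid_point j Q z).
  by exists Q, z, z; split=> //; rewrite /grid_adj zg !leqnSn.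
by exists q.
Qed.

(** This is [dist A B <= r] with the level of the refinement left free. Paths on
    different levels can be brought to a common one, whence the triangle inequality. *)
Definition near A B r : Prop :=
  exists j n, [/\ is_node M0 j A, is_node M0 j B, reach M0 j n A B &
                  n%:R / 2 ^+ j <= r].

Lemma near_le A B r s : near A B r -> r <= s -> near A B s.
Proof.
move=> [j [n [nA nB rn h]]] rs; exists j, n; split=> //; exact: le_trans rs.
Qed.

Lemma is_node_add j k A : is_node M0 j A -> is_node M0 (j + k) A.
Proof. by move=> nA; elim: k => [|k IH]; rewrite ?addn0 // addnS; apply: is_nodeS. Qed.

Lemma reach_refines j k n A B : reach M0 j n A B ->
  exists2 m, reach M0 (j + k) m A B & m%:R / (2 : R) ^+ (j + k) = n%:R / 2 ^+ j.
Proof.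
move=> r; elim: k => [|k [m rm e]]; first by exists n; rewrite addn0.
exists m.*2; rewrite addnS; first exact: reach_refine.
rewrite -e -muln2 natrM exprS.
have p : (2 : R) ^+ (j + k) != 0 by rewrite lt0r_neq0 ?pow2_gt0.
by field.
Qed.

Lemma reach_coarsens j k n A B : is_node M0 j A -> is_node M0 j B ->
  reach M0 (j + k) n A B ->
  exists2 m, reach M0 j m A B & m%:R / 2 ^+ j <= n%:R / (2 : R) ^+ (j + k).
Proof.
move=> nA nB; elim: k n => [|k IH] n; first by rewrite addn0; exists n.
rewrite addnS => /reach_coarsen[||m mn /IH[m' r h]]; try exact: is_node_add.
exists m' => //; apply: le_trans h _; rewrite exprS.
have p : 0 < (2 : R) ^+ (j + k) by apply: pow2_gt0.
rewrite invfM mulrA ler_pM2r ?invr_gt0 // ler_pdivlMr //.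
by rewrite -natrM ler_nat muln2.
Qed.

Lemma near_level j A B r : near A B r -> is_node M0 j A -> is_node M0 j B ->
  exists2 n, reach M0 j n A B & n%:R / 2 ^+ j <= r.
Proof.
move=> [i [n [nA nB rn h]]] nA' nB'; have [ij|ji] := leqP i j.
  have [m rm e] := reach_refines (j - i) rn; rewrite subnKC // in rm e.
  by exists m; rewrite ?e.
have e : (j + (i - j))%N = i by rewrite subnKC // ltnW.
rewrite -e in rn h; have [m rm hm] := reach_coarsens nA' nB' rn.
by exists m => //; apply: le_trans h.
Qed.

Lemma near_trans A B V r s : near A V r -> near V B s -> near A B (r + s).
Proof.
move=> h1 h2; have [j1 [n1 [nA nV _ _]]] := h1; have [j2 [n2 [nV' nB _ _]]] := h2.
have nA' := is_node_add j2 nA; have nV2 := is_node_add j2 nV.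
have nB' := is_node_add j1 nB; rewrite addnC in nB'.
have [m1 r1 e1] := near_level h1 nA' nV2.
have [m2 r2 e2] := near_level h2 nV2 nB'.
exists (j1 + j2)%N, (m1 + m2)%N; split=> //; first exact: reach_cat r1 r2.
by rewrite natrD mulrDl lerD.
Qed.

Lemma dist_levelP j A B r :
  reflect (exists2 n, reach M0 j n A B & n%:R <= r) (dist_level M0 j A B <= r%:E)%E.
Proof.
apply: (iffP idP) => [le|[n /joins_reach[s sn sj] nr]]; last first.
  apply: le_trans (_ : n%:R%:E <= _)%E; last by rewrite lee_fin.
  by apply: ereal_inf_lbound; exists s => //; rewrite sn.
have [n0 rn0] : exists n, reach M0 j n A B.
  apply: contrapT => none; move: le; rewrite /dist_level.
  set S := (X in ereal_inf X); have -> : S = set0; last first.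
    by rewrite ereal_inf0 leye_eq.
  apply/seteqP; split=> // y [s sj _]; apply: none; exists (size s).
  by apply/joins_reach; exists s.
have ex : exists n, `[< reach M0 j n A B >] by exists n0; apply/asboolP.
case: (ex_minnP ex) => m /asboolP rm min; exists m => //.
rewrite -lee_fin; apply: le_trans le.
apply: le_ereal_inf_tmp => _ [s sj <-]; rewrite lee_fin ler_nat; apply: min.
by apply/asboolP/joins_reach; exists s.
Qed.

(** The level that [dist] picks is unknown, but a path on any level can be moved to
    it. *)
Lemma distP j A B r : is_node M0 j A -> is_node M0 j B ->
  (dist M0 A B <= r%:E)%E <-> near A B r.
Proof.
move=> nA nB; rewrite /dist /=.
set i := xget _ _; have [nA' nB'] : is_node M0 i A /\ is_node M0 i B.
  rewrite /i; case: xgetP => [k -> /= [/is_node_uniform ? /is_node_uniform ?] //|].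
  by move=> /(_ j) []; split; apply/is_node_uniform.
have p : 0 < (2 : R) ^+ i by apply: pow2_gt0.
have -> : ((2 ^- i)%:E * dist_level M0 i A B <= r%:E)%E =
          (dist_level M0 i A B <= (r * 2 ^+ i)%:E)%E.
  by rewrite lee_pdivrMl // EFinM muleC.
split=> [/dist_levelP[n rn h]|/near_level h].
  by exists i, n; split=> //; rewrite ler_pdivrMr.
have [n rn h'] := h _ nA' nB'.
by apply/dist_levelP; exists n => //; rewrite -ler_pdivrMr.
Qed.

Lemma near_dist A B r : near A B r -> (dist M0 A B <= r%:E)%E.
Proof.
by move=> nAB; have [j [n [nA nB _ _]]] := nAB; apply/(distP r nA nB).
Qed.

(** * Distances of points with dyadic parameters *)

Definition dyadic u : Prop := exists j z, in_grid (2 ^ j) z /\ u = grid_coord R j z.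

Lemma dyadic_closed u : dyadic u -> closed_square u.
Proof. by move=> [j [z [zg ->]]]; apply: grid_coord_closed. Qed.

Lemma in_gridD j k z : in_grid (2 ^ j) z -> exists2 w, in_grid (2 ^ (j + k)) w &
  grid_coord R (j + k) w = grid_coord R j z.
Proof.
move=> zg; elim: k => [|k [w wg e]]; first by exists z; rewrite ?addn0.
exists (w.1.*2, w.2.*2); last by rewrite addnS grid_coord_double.
by move: wg; rewrite /in_grid addnS /= expnS; lia.
Qed.

Lemma dyadic_common u v : dyadic u -> dyadic v ->
  exists j z w, [/\ in_grid (2 ^ j) z, in_grid (2 ^ j) w, u = grid_coord R j z &
                    v = grid_coord R j w].
Proof.
move=> [j [z [zg ->]]] [k [w [wg ->]]].
have [z' zg' ez] := in_gridD k zg; have [w' wg' ew] := in_gridD j wg.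
by rewrite addnC in wg' ew; exists (j + k)%N, z', w'.
Qed.

Lemma dyadic_midpt u v : dyadic u -> dyadic v -> dyadic (midpt u v).
Proof.
move=> du dv; have [j [z [w [zg wg -> ->]]]] := dyadic_common du dv.
rewrite midpt_grid_coord; exists j.+1, (z.1 + w.1, z.2 + w.2)%N; split=> //.
by move: zg wg; rewrite /in_grid /= expnS; lia.
Qed.

Lemma dyadic_pair u v : dyadic u -> dyadic v -> dyadic (u.1, v.2).
Proof.
move=> du dv; have [j [z [w [zg wg -> ->]]]] := dyadic_common du dv.
exists j, (z.1, w.2); split=> //.
by move: zg wg; rewrite /in_grid /=; lia.
Qed.

(** Steps may be diagonal, so within one cell of the initial mesh the distance is
    that of the maximum norm of the parameters. *)
Lemma near_in_cell Q u v r : dyadic u -> dyadic v ->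
  `|u.1 - v.1| <= r -> `|u.2 - v.2| <= r -> near (par Q u) (par Q v) r.
Proof.
move=> du dv; have [j [z [w [zg wg -> ->]]]] := dyadic_common du dv.
have p : 0 < (2 : R) ^+ j by apply: pow2_gt0.
rewrite /= -!mulrBl !normrM [`|(2 ^+ j)^-1|]gtr0_norm ?invr_gt0 // => h1 h2.
have normD (x y : nat) : `|x%:R - y%:R : R| = ((x - y) + (y - x))%:R.
  have [xy|/ltnW xy] := leqP x y.
    by rewrite distrC -natrB // normr_nat (_ : x - y = 0)%N ?add0n //; lia.
  by rewrite -natrB // normr_nat (_ : y - x = 0)%N ?addn0 //; lia.
pose n := maxn ((z.1 - w.1) + (w.1 - z.1)) ((z.2 - w.2) + (w.2 - z.2)).
exists j, n; split; [by exists Q, z|by exists Q, w| |].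
  by apply: reach_in_cell => //; rewrite /n; lia.
rewrite normD in h1; rewrite normD in h2.
by rewrite /n; have [_|_] := leqP.
Qed.

Lemma dyadic_dist Q Q' u v r : dyadic u -> dyadic v ->
  (dist M0 (par Q u) (par Q' v) <= r%:E)%E <-> near (par Q u) (par Q' v) r.
Proof.
move=> du dv; have [j [z [w [zg wg -> ->]]]] := dyadic_common du dv.
by apply: (@distP j); [exists Q, z|exists Q', w].
Qed.

End MeshDistance.

(** * Edges with dyadic end points *)

Section MeshInvariant.
Variables (R : realType) (d : nat) (M0 : initial_mesh R d).
Implicit Types (Q : cell M0) (q : element M0) (E F : edge R d) (M : mesh M0).
Implicit Types (u v a b : R * R) (i k : 'I_4).

(** The bound on the extent is inherited by the halves of a segment, whatever its
    direction in the parameter square. *)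
Definition dyadic_edge E : Prop :=
  exists Q a b, [/\ dyadic a, dyadic b, a <> b, locus E = seg Q a b &
    `|a.1 - b.1| <= 2 ^- level E /\ `|a.2 - b.2| <= 2 ^- level E].

Lemma halve_pow2 n : (2 : R) ^- n.+1 = 2 ^- n / 2.
Proof. by rewrite exprS invfM mulrC. Qed.

Lemma mid_dyadic E : dyadic_edge E ->
  exists Q u, dyadic u /\ mid M0 E = par Q u.
Proof.
move=> [Q [a [b [da db ab e _]]]]; exists Q, (midpt a b).
split; first exact: dyadic_midpt.
by apply: midE e => //; exact: dyadic_closed.
Qed.

Lemma midpt_neq a b : a <> b -> a <> midpt a b.
Proof.
move=> ab; rewrite -{1}(affine0 a b) => /(affine_inj ab) /eqP.
by rewrite eq_sym invr_eq0 pnatr_eq0.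
Qed.

(** The midpoints of an edge and of its child are a quarter of the length of the
    edge apart, that is, half the length of the child. *)
Lemma child_dyadic E F : dyadic_edge E -> children M0 E F ->
  [/\ dyadic_edge F, level F = (level E).+1 &
      near M0 (mid M0 E) (mid M0 F) (2^-1 * 2 ^- level F)].
Proof.
move=> [Q [a [b [da db ab e [l1 l2]]]]].
have ca := dyadic_closed da; have cb := dyadic_closed db.
have dm := dyadic_midpt da db; have cm := dyadic_closed dm.
rewrite (childrenE F ca cb ab e) (midE ca cb ab e).
have half c : c = a \/ c = b -> F = Edge (seg Q c (midpt a b)) (level E).+1 (di E) ->
  [/\ dyadic_edge F, level F = (level E).+1 &
      near M0 (par Q (midpt a b)) (mid M0 F) (2^-1 * 2 ^- level F)].
  move=> hc eF.
  have dc : dyadic c by case: hc => ->.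
  have cn : c <> midpt a b.
    by case: hc => ->; [|rewrite midptC]; apply: midpt_neq => // eab; apply: ab.
  have len1 : `|c.1 - (midpt a b).1| <= 2 ^- (level E).+1.
    by rewrite halve_pow2; move: l1; case: hc => ->; rewrite /midpt /affine /= !ler_norml; lra.
  have len2 : `|c.2 - (midpt a b).2| <= 2 ^- (level E).+1.
    by rewrite halve_pow2; move: l2; case: hc => ->; rewrite /midpt /affine /= !ler_norml; lra.
  have lF : locus F = seg Q c (midpt a b) by rewrite eF.
  split; [|by rewrite eF|].
    by exists Q, c, (midpt a b); rewrite eF /=; split.
  rewrite (midE (dyadic_closed dc) cm cn lF) eF /=.
  apply: near_in_cell; [exact: dm|exact: dyadic_midpt| |];
    [move: len1|move: len2]; rewrite /midpt /affine /= !ler_norml; lra.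
by move=> [] eF; apply: half eF; [left|right].
Qed.

(** * Elements and their bisection *)

(** The grading, an aspect ratio of at most two, is what bounds the level of a
    bisector by that of the edge whose subdivision has created it. *)
Definition graded_element q : Prop :=
  [/\ dyadic (lo q), dyadic (hi q), (hi q).1 - (lo q).1 = 2 ^- hlevel q,
      (hi q).2 - (lo q).2 = 2 ^- vlevel q &
      (hlevel q <= (vlevel q).+1)%N && (vlevel q <= (hlevel q).+1)%N].

Definition side_center q i : R * R :=
  midpt (corner (lo q) (hi q) i) (corner (lo q) (hi q) (i + 1)).

Lemma side_centerE q :
  [/\ side_center q 0 = (((lo q).1 + (hi q).1) / 2, (lo q).2),
      side_center q 1 = ((hi q).1, ((lo q).2 + (hi q).2) / 2),
      side_center q 2 = (((lo q).1 + (hi q).1) / 2, (hi q).2) &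
      side_center q 3 = ((lo q).1, ((lo q).2 + (hi q).2) / 2)].
Proof.
by split; rewrite /side_center /midpt /affine /corner /=; congr (_, _); field.
Qed.

Lemma corner_dyadic q i : graded_element q -> dyadic (corner (lo q) (hi q) i).
Proof.
move=> [dl dh _ _ _]; have := dyadic_pair dl dh; have := dyadic_pair dh dl.
move: (dyadic_pair dl dl) (dyadic_pair dh dh).
by move: i; apply: ord4P.
Qed.

Lemma side_center_dyadic q i : graded_element q -> dyadic (side_center q i).
Proof. by move=> gq; apply: dyadic_midpt; exact: corner_dyadic. Qed.

Lemma pow2V_gt0 n : 0 < (2 : R) ^- n.
Proof. by rewrite invr_gt0 exprn_gt0. Qed.

Lemma element_corner_neq q i : graded_element q ->
  corner (lo q) (hi q) i <> corner (lo q) (hi q) (i + 1).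
Proof.
move=> [_ _ w h _]; have := pow2V_gt0 (hlevel q); have := pow2V_gt0 (vlevel q).
by rewrite -w -h; move: i; apply: ord4P; rewrite /corner /= => ? ? []; lra.
Qed.

Lemma side_dyadic q i : graded_element q -> dyadic_edge (side q i).
Proof.
move=> gq; exists (base q), (corner (lo q) (hi q) i), (corner (lo q) (hi q) (i + 1)).
split=> //; try exact: corner_dyadic; first exact: element_corner_neq.
case: gq => _ _ w h _; have := pow2V_gt0 (hlevel q); have := pow2V_gt0 (vlevel q).
by move: i; apply: ord4P; rewrite /side /corner /= -w -h; split; rewrite ler_norml; lra.
Qed.

Lemma mid_side q i : graded_element q -> mid M0 (side q i) = par (base q) (side_center q i).
Proof.
move=> gq; apply: (@midE _ _ _ (side q i)) => //.
- exact/dyadic_closed/corner_dyadic.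
- exact/dyadic_closed/corner_dyadic.
- exact: element_corner_neq.
Qed.

Lemma opposite_side_neq q i : graded_element q -> side q i <> side q (i + 2).
Proof.
move=> gq e; have := mid_side i gq; rewrite e (mid_side _ gq) => ec.
have {ec} := par_inj (dyadic_closed (side_center_dyadic _ gq))
                     (dyadic_closed (side_center_dyadic _ gq)) ec.
have [c0 c1 c2 c3] := side_centerE q.
case: gq => _ _ w h _; have := pow2V_gt0 (hlevel q); have := pow2V_gt0 (vlevel q).
rewrite -w -h {e}; move: i.
by apply: ord4P => /=; rewrite ?c0 ?c1 ?c2 ?c3 => ? ? []; lra.
Qed.

Lemma bisectorE q i :
  bisector q i = Edge (seg (base q) (side_center q i) (side_center q (i + 2)))
                      (level (side q (i + 1))) (di (side q (i + 1))).
Proof.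
rewrite /bisector /side_center; congr Edge; congr (seg _ _ (midpt _ (corner _ _ _))).
by rewrite -addrA; congr (i + _); apply: val_inj.
Qed.

Lemma ord4_add :
  (((0 + 1)%R = 1%R :> 'I_4) * ((1 + 1)%R = 2%R :> 'I_4) * ((2 + 1)%R = 3%R :> 'I_4) *
   ((3 + 1)%R = 0%R :> 'I_4) * ((0 + 2)%R = 2%R :> 'I_4) * ((1 + 2)%R = 3%R :> 'I_4) *
   ((2 + 2)%R = 0%R :> 'I_4) * ((3 + 2)%R = 1%R :> 'I_4))%type.
Proof. by do !split; apply: val_inj. Qed.

Lemma near_adjacent_sides q i k r : graded_element q -> k = i + 1 \/ k = i + 1 + 2 ->
  2 ^- hlevel q / 2 <= r -> 2 ^- vlevel q / 2 <= r ->
  near M0 (mid M0 (side q i)) (mid M0 (side q k)) r.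
Proof.
move=> gq hk; rewrite !mid_side //; have [c0 c1 c2 c3] := side_centerE q.
have [_ _ w h _] := gq; have := pow2V_gt0 (hlevel q); have := pow2V_gt0 (vlevel q).
rewrite -w -h => p1 p2 hr vr; apply: near_in_cell; try exact: side_center_dyadic.
- by case: hk => ->; move: i; apply: ord4P; rewrite ?ord4_add ?c0 ?c1 ?c2 ?c3 /= ler_norml; lra.
- by case: hk => ->; move: i; apply: ord4P; rewrite ?ord4_add ?c0 ?c1 ?c2 ?c3 /= ler_norml; lra.
Qed.

(** The bisector starts at the midpoint of side [i], so the distance of the two
    midpoints is half the length of the bisector. *)
Lemma bisector_dyadic q i : graded_element q ->
  dyadic_edge (bisector q i) /\
  near M0 (mid M0 (side q i)) (mid M0 (bisector q i)) (2^-1 * 2 ^- level (bisector q i)).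
Proof.
move=> gq; have [c0 c1 c2 c3] := side_centerE q.
have [_ _ w h _] := gq; have p1 := pow2V_gt0 (hlevel q); have p2 := pow2V_gt0 (vlevel q).
have d1 := side_center_dyadic i gq; have d2 := side_center_dyadic (i + 2) gq.
have neq : side_center q i <> side_center q (i + 2).
  move: p1 p2; rewrite -w -h => p1 p2; move: (i).
  by apply: ord4P; rewrite ?ord4_add ?c0 ?c1 ?c2 ?c3 => -[]; lra.
have len : `|(side_center q i).1 - (side_center q (i + 2)).1| <= 2 ^- level (bisector q i) /\
           `|(side_center q i).2 - (side_center q (i + 2)).2| <= 2 ^- level (bisector q i).
  rewrite bisectorE /=; move: p1 p2; move: (i).
  by apply: ord4P; rewrite ?ord4_add ?c0 ?c1 ?c2 ?c3 /= -w -h !ler_norml; lra.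
have lB : locus (bisector q i) = seg (base q) (side_center q i) (side_center q (i + 2)).
  by rewrite bisectorE.
split; first by exists (base q), (side_center q i), (side_center q (i + 2)).
rewrite (midE (dyadic_closed d1) (dyadic_closed d2) neq lB) mid_side //.
apply: near_in_cell => //; first exact: dyadic_midpt.
- by move: len => [+ _]; rewrite /midpt /affine /= !ler_norml; lra.
- by move: len => [_]; rewrite /midpt /affine /= !ler_norml; lra.
Qed.

(** Each half has sides that are edges of the subdivided mesh in both directions: a
    child of the subdivided edge and the bisector. *)
Lemma half_sides q i q' : graded_element q -> halves q i q' ->
  children M0 (side q i) (side q' i) /\
  (side q' (i + 1) = bisector q i \/ side q' (i + 1 + 2) = bisector q i).
Proof.
move=> gq; have ch := childrenE _ (dyadic_closed (corner_dyadic i gq))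
  (dyadic_closed (corner_dyadic (i + 1) gq)) (element_corner_neq (i := i) gq)
  (erefl (locus (side q i))).
rewrite ch bisectorE {ch} -/(side_center q i).
have [c0 c1 c2 c3] := side_centerE q; move: gq c0 c1 c2 c3 => _.
case: q => Q l h hl vl hd vd; rewrite /halves /=.
move=> c0 c1 c2 c3.
have mE x y : (1 - 2^-1) * x + 2^-1 * y = (x + y) / 2 :> R by field.
have flip F Q1 a b m e : F = Edge (seg Q1 b a) m e -> F = Edge (seg Q1 a b) m e.
  by rewrite segC.
move: i; apply: ord4P; rewrite ?ord4_add ?c0 ?c1 ?c2 ?c3 /= => -[] ->;
  rewrite !mE /side /corner /=; split;
  first [by left | by right | by left; apply: flip | by right; apply: flip].
Qed.

Lemma half_graded q i q' : graded_element q -> halves q i q' ->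
  (level (side q i) <= level (side q (i + 1)%R))%N -> graded_element q'.
Proof.
move=> gq hq'; have dc := dyadic_midpt (let: And5 dl _ _ _ _ := gq in dl)
  (let: And5 _ dh _ _ _ := gq in dh).
case: q gq hq' dc => Q l h hl vl hd vd [/= dl dh w t lv] hq' dc.
move: i hq'; apply: ord4P; rewrite ?ord4_add /halves /= => -[] -> hv;
  split=> //=; rewrite ?halve_pow2; try (by lra); try (by lia);
  first [exact: dyadic_pair dc dh | exact: dyadic_pair dc dl
       | exact: dyadic_pair dh dc | exact: dyadic_pair dl dc].
Qed.

(** * Invariants of the mesh *)

(** The second condition expresses that an element is bisected as soon as two
    opposite sides of it have been subdivided. *)
Definition graded_mesh M : Prop :=
  (forall F, edges M F -> dyadic_edge F) /\
  (forall q, elements M q -> graded_element q /\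
     forall i, edges M (side q i) \/ edges M (side q (i + 2))).

Lemma graded_mesh0 : graded_mesh (mesh0 M0).
Proof.
have g0 Q : graded_element (initial_element Q).
  have d0 : dyadic (0 : R, 0).
    by exists 0%N, (0, 0)%N; split=> //; rewrite /grid_coord /= expr0 !divr1.
  have d1 : dyadic (1 : R, 1).
    by exists 0%N, (1, 1)%N; split=> //; rewrite /grid_coord /= expr0 !divr1.
  by split=> //=; rewrite expr0 invr1 subr0.
split=> [F [q [Q _ <-] [i _ <-]]|q qM]; first exact: side_dyadic.
split=> [|i]; first by case: qM => Q _ <-.
by left; exists q => //; exists i.
Qed.

(** At most one of the two sides of [q] adjacent to [E] has been subdivided, since
    otherwise [q] would have been bisected between them. If the other one had a lower
    level than [E], it would lie in the neighborhood of [E] and be pending. *)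
Lemma split_level p M E q i : (0 < p)%N -> graded_mesh M ->
  pending p M E = set0 -> to_split M E q i ->
  (level (side q i) <= level (side q (i + 1)%R))%N.
Proof.
move=> p0 [Me Mq] pend [qM qE nE]; have [gq sides] := Mq _ qM.
rewrite leqNgt; apply/negP => lt.
have [k hk kM] : exists2 k, k = i + 1 \/ k = i + 1 + 2 & edges M (side q k).
  by case: (sides (i + 1)) => ?; [exists (i + 1)|exists (i + 1 + 2)]; auto.
have lk : level (side q k) = level (side q (i + 1)).
  by case: hk => ->; rewrite //; move: (i); apply: ord4P; rewrite ?ord4_add.
suff : pending p M E (side q k) by rewrite pend.
split; last by left; rewrite lk -qE.
split=> //; rewrite /edge_dist -qE !mid_side //.
apply/dyadic_dist; try exact: side_center_dyadic.
rewrite -!mid_side //; apply: near_adjacent_sides => //.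
all: have p1 : (1 : R) <= p%:R by rewrite ler1n.
all: have h2 := pow2V_gt0 (level (side q i)).
all: rewrite -[p.+1]addn1 natrD.
all: have lv : level (side q i) = (level (side q (i + 1))).+1.
1, 3: have [_ _ _ _ /andP[g1 g2]] := gq; move: lt; move: (i) g1 g2.
1, 2: by apply: ord4P; rewrite ?ord4_add /=; lia.
all: have e := halve_pow2 (level (side q (i + 1))); rewrite -lv in e.
all: move: h2 e {lv lk lt qE nE}; move: hk => _; move: (i).
all: by apply: ord4P; rewrite ?ord4_add /=; nra.
Qed.

Lemma subdiv_graded p M E : (0 < p)%N -> graded_mesh M -> edges M E ->
  pending p M E = set0 -> graded_mesh (subdiv M E).
Proof.
move=> p0 gM EM pend; have [Me Mq] := gM.
have split_lv q i := split_level (q := q) (i := i) p0 gM pend.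
split=> [F [[[FM _]|]|[q [i [ts ->]]]]|q].
- exact: Me.
- by move=> chF; have [] := child_dyadic (Me _ EM) chF.
- by case: ts => qM _ _; have [gq _] := Mq _ qM; have [] := bisector_dyadic i gq.
case=> [[qM nts]|[q0 [i [ts hq]]]].
- have [gq sides] := Mq _ qM; split=> // i.
  have keep F : edges M F -> F <> E -> edges (subdiv M E) F by move=> ? ?; do 2 left.
  have flip k : side q k = E -> edges (subdiv M E) (side q (k + 2)).
    move=> kE; apply: keep; last by rewrite -kE => e; apply: (opposite_side_neq (i := k) gq).
    by apply: contrapT => nk; apply: nts; exists k.
  have [iM|iM] := sides i.
    have [iE|iE] := pselect (side q i = E); last by left; apply: keep.
    by right; apply: flip.
  have [iE|iE] := pselect (side q (i + 2) = E); last by right; apply: keep.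
  left; rewrite (_ : i = i + 2 + 2); first exact: flip.
  by rewrite -addrA (_ : 2 + 2 = 0) ?addr0 //; apply: val_inj.
- have [qM qE _] := ts; have [gq _] := Mq _ qM.
  split=> [|k]; first exact: half_graded gq hq (split_lv _ _ ts).
  have [ch bi] := half_sides gq hq; rewrite qE in ch.
  have chM : edges (subdiv M E) (side q i) by left; right.
  have biM : edges (subdiv M E) (side q (i + 1)) \/ edges (subdiv M E) (side q (i + 1 + 2)).
    by case: bi => ->; [left|right]; right; exists q0, i.
  have : k = i \/ i = k + 2 \/ k = i + 1 \/ k = i + 1 + 2.
    move: (i) (k); apply: ord4P; apply: ord4P; rewrite ?ord4_add; auto.
  move=> [->|[ik|[->//|ik]]]; first by left.
  + by right; rewrite -ik.
  + rewrite or_comm (_ : k + 2 = i + 1); first by rewrite ik.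
    by rewrite ik -addrA (_ : 2 + 2 = 0) ?addr0 //; apply: val_inj.
Qed.

(** A child lies one level below [E]. A bisector has the level of the sides adjacent
    to [E] of a graded element. In both cases half the length of the new edge
    separates its midpoint from that of [E]. *)
Lemma new_edge p M E F : (0 < p)%N -> graded_mesh M -> edges M E ->
  pending p M E = set0 -> edges (subdiv M E) F -> ~ edges M F ->
  (level F <= (level E).+1)%N /\
  near M0 (mid M0 E) (mid M0 F) (2^-1 * 2 ^- level F).
Proof.
move=> p0 gM EM pend FM' FM; have [Me Mq] := gM.
case: FM' => [[[//]|]|[q [i [[qM qE nE] ->]]]].
- by move=> chF; have [_ -> ?] := child_dyadic (Me _ EM) chF.
- have [gq _] := Mq _ qM; have [_] := bisector_dyadic i gq; rewrite qE; split=> //.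
  rewrite bisectorE -qE /=; have [_ _ _ _ /andP[]] := gq.
  by move: (i); apply: ord4P; rewrite ?ord4_add.
Qed.

End MeshInvariant.

(** * Executions of the refinement procedure *)

Scheme refine_mut := Minimality for refine Sort Prop
  with while_mut := Minimality for while_pending Sort Prop
  with refine_all_mut := Minimality for refine_all Sort Prop.

Section Execution.
Variables (R : realType) (d : nat) (M0 : initial_mesh R d) (p : nat).
Hypothesis p_gt0 : (0 < p)%N.
Implicit Types (E F G : edge R d) (M : mesh M0) (st ch : seq (edge R d)).

Lemma precedes_trans F E G : precedes F E -> precedes E G -> precedes F G.
Proof. by rewrite /precedes; lia. Qed.

Definition call_link E F : Prop :=
  near M0 (mid M0 E) (mid M0 F) (p.+1%:R / 2 * 2 ^- level E) /\ precedes F E.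

(** Calls are listed with the innermost first, as in the log; [E] is the outermost. *)
Inductive call_chain : edge R d -> seq (edge R d) -> Prop :=
  | chain_last E : dyadic_edge M0 E -> call_chain E [:: E]
  | chain_call E F ch :
      call_link E F -> call_chain F ch -> call_chain E (rcons ch E).

Definition created_near E F : Prop :=
  (level F <= (level E).+1)%N /\
  near M0 (mid M0 E) (mid M0 F) (2^-1 * 2 ^- level F).

Definition logged_from E st (log : call_log R d) : Prop :=
  forall ch F, log (ch, F) -> exists ch', [/\ ch = ch' ++ st, call_chain E ch' &
    created_near (head E ch') F].

Lemma pending_link M E F : graded_mesh M -> edges M E -> pending p M E F ->
  call_link E F.
Proof.
move=> [dM _] EM [[FM near_EF] prec]; split=> //; move: near_EF.
rewrite /edge_dist; have [Q [u [du ->]]] := mid_dyadic (dM _ EM).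
by have [P [v [dv ->]]] := mid_dyadic (dM _ FM); move/dyadic_dist; apply.
Qed.

(** Nested calls only subdivide edges that precede the edge of the calling
    procedure; so this edge is still there when its turn has come. *)
Lemma refine_execution st M E M' log : refine p st M E M' log ->
  graded_mesh M -> edges M E ->
  [/\ graded_mesh M', forall F, edges M F -> precedes E F -> edges M' F &
      logged_from E st log].
Proof.
move: st M E M' log.
(* inside the loop of [E], the stack [st] already starts with [E], so that the log
   contains chains of calls made by [E] on top of [st] *)
pose kept E M M' := forall F, edges M F -> E = F \/ precedes E F -> edges M' F.
pose nested E st log := forall ch F, log (ch, F) ->
  exists E', call_link E E' /\ exists ch', [/\ ch = ch' ++ st, call_chain E' ch' &
     created_near (head E' ch') F].
apply: (@refine_mut R d M0 p _
  (fun st M E M' log => graded_mesh M -> edges M E ->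
     [/\ graded_mesh M', pending p M' E = set0, kept E M M' & nested E st log])
  (fun st M s M' log => forall E, graded_mesh M ->
     (forall F, F \in s -> call_link E F) ->
     [/\ graded_mesh M', kept E M M' & nested E st log])).
- move=> st M E M1 log _ IH gM EM; have [g1 pend kp nst] := IH gM EM.
  have E1 : edges M1 E by apply: kp => //; left.
  split.
  + exact: subdiv_graded g1 E1 pend.
  + move=> F FM EF; left; left; split; first by apply: kp => //; right.
    by move=> eF; move: EF; rewrite /= in eF; rewrite eF /precedes; lia.
  + move=> ch F [/nst[E' [lk [ch' [-> cc cr]]]]|[/= -> [FS F1]]].
    * exists (rcons ch' E); split; [by rewrite cat_rcons|exact: chain_call cc|].
      by move: cr; case: cc => [//|? ? ch'' _ _]; case: ch''.
    * exists [:: E]; split=> //; first by apply: chain_last; case: g1 => dM _; apply: dM.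
      by split; have [] := new_edge p_gt0 g1 E1 pend FS F1.
- by move=> st M E pend gM EM; split=> //; move=> ch F.
- move=> st M E s M1 log1 M2 log2 _ _ es _ IH1 _ IH2 gM EM.
  have [|g1 k1 n1] := IH1 E gM.
    move=> F Fs; apply: pending_link gM EM _.
    by rewrite -es.
  have E1 : edges M1 E by apply: k1 => //; left.
  have [g2 pend k2 n2] := IH2 g1 E1; split=> //.
  + by move=> F FM EF; apply: k2 => //; apply: k1.
  + by move=> ch F [/n1|/n2].
- by move=> st M E gM _; split=> //; move=> ch F.
- move=> st M F s M1 log _ _ IH E gM lk; apply: IH => // G Gs.
  by apply: lk; rewrite inE Gs orbT.
- move=> st M F s M1 log1 M2 log2 FM _ IH1 _ IH2 E gM lk.
  have lF : call_link E F by apply: lk; rewrite mem_head.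
  have [g1 k1 l1] := IH1 gM FM.
  have [|g2 k2 n2] := IH2 E g1; first by move=> G Gs; apply: lk; rewrite inE Gs orbT.
  split=> //.
  + move=> G GM EG; apply: k2 => //; apply: k1 => //.
    case: lF => _ FE; case: EG => [<- //|]; exact: precedes_trans.
  + move=> ch G [/l1[ch' [-> cc cr]]|/n2 //]; exists F; split=> //.
    by exists ch'.
Qed.

Lemma generated_graded M : generated p M -> graded_mesh M.
Proof.
elim=> [|{}M E M' log _ gM EM /refine_execution h]; first exact: graded_mesh0.
by have [] := h gM EM.
Qed.

End Execution.

(** * The geometric series and the constant *)

Section Root.
Variables (R : realType) (K : nat).
Hypothesis K_gt0 : (0 < K)%N.

Definition root2 : R := 2 `^ K%:R^-1.

Lemma root2X : root2 ^+ K = 2.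
Proof.
rewrite -powR_mulrn ?powR_ge0 // -powRrM mulVf ?powRr1 //.
by rewrite pnatr_eq0 -lt0n.
Qed.

Lemma root2_gt1 : 1 < root2.
Proof.
rewrite ltNge; apply/negP => le1.
have : root2 ^+ K <= 1 by apply: exprn_ile1 => //; apply: powR_ge0.
by rewrite root2X; lra.
Qed.

(** [1 = root2 ^ K - 1] is [root2 - 1] times a sum of [K] powers, all at most [2]. *)
Lemma root2_lower : 1 <= (root2 - 1) * (2 * K%:R).
Proof.
have y1 := root2_gt1.
have e : 1 = (root2 - 1) * \sum_(i < K) root2 ^+ i.
  by rewrite -subrX1 root2X; ring.
rewrite {1}e ler_pM2l ?subr_gt0 // mulr_natr -[X in _ *+ X](card_ord K) -sumr_const.
apply: ler_sum => i _; rewrite -root2X.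
by apply: ler_weXn2l; [exact: ltW|exact: ltnW].
Qed.

(** The sum of the powers of [root2^-1] from [a] to [m], scaled by
    [root2 ^ (K - 1)]. *)
Definition geometric a m : R :=
  root2 ^+ K.-1 * (root2^-1 ^+ a - root2^-1 ^+ m.+1) / (1 - root2^-1).

Lemma root2V_01 : 0 < root2^-1 < 1.
Proof. by have y1 := root2_gt1; rewrite invr_gt0 invf_lt1; lra. Qed.

(** As [2 = root2 ^ K], the upper bound on [m'] says that [2 ^- l] is at most the
    [m']-th of the terms that [geometric] sums. *)
Lemma geometric_step a m m' l : (m < m')%N -> (m' <= K * l + K.-1)%N ->
  2 ^- l + geometric a m <= geometric a m'.
Proof.
move=> mm' m'l; have y1 := root2_gt1; have r01 := root2V_01; rewrite /geometric.
have step : root2^-1 ^+ m' <= root2^-1 ^+ m.+1 by apply: ler_wiXn2l => //; lra.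
have len : 2 ^- l <= root2 ^+ K.-1 * root2^-1 ^+ m'.
  have -> : 2 ^- l = root2 ^+ K.-1 * root2^-1 ^+ (K * l + K.-1).
    rewrite exprD mulrCA -exprMn divff ?expr1n ?mulr1; last lra.
    by rewrite exprM exprVn root2X // exprVn.
  by apply: ler_wpM2l; [rewrite exprn_ge0 //; lra|apply: ler_wiXn2l => //; lra].
have Y0 : 0 <= root2 ^+ K.-1 by rewrite exprn_ge0 //; lra.
rewrite ler_pdivlMr; last by lra.
rewrite mulrDl divfK; last by lra.
rewrite [root2^-1 ^+ m'.+1]exprS; nra.
Qed.

(** The finite sum is less than the series, which is [root2 ^ (K - 1)] times
    [root2^-1 ^ (h + 1) / (1 - root2^-1)]. One factor [2] comes from replacing [l] by
    [l'], another one from [root2 ^ (K - 1) = 2 / root2]. *)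
Lemma geometric_lt h m l l' : (K * l <= h)%N -> (l' <= l.+1)%N ->
  2^-1 * geometric h.+1 m < 2 / (root2 * (root2 - 1)) * 2 ^- l'.
Proof.
move=> hl ll'; have y1 := root2_gt1; have r01 := root2V_01; rewrite /geometric.
have Y0 : 0 < root2 ^+ K.-1 by rewrite exprn_gt0 //; lra.
have m0 : 0 < root2^-1 ^+ m.+1 by rewrite exprn_gt0 //; lra.
have h1 : root2^-1 ^+ h <= 2 ^- l.
  rewrite -root2X -exprM -exprVn; apply: ler_wiXn2l => //; lra.
have l1 : 2 ^- l <= 2 * 2 ^- l' :> R.
  by rewrite -ler_pdivrMl // -invfM -exprS lef_pV2 ?posrE ?exprn_gt0 // ler_weXn2l // ler1n.
have Y2 : root2 ^+ K.-1 * root2 = 2 by rewrite -exprSr prednK // root2X.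
have e : 2 / (root2 * (root2 - 1)) = 2^-1 * (root2 ^+ K.-1 * (root2^-1 * 2)) / (1 - root2^-1).
  have -> : root2 ^+ K.-1 = 2 / root2 by rewrite -Y2 mulfK //; lra.
  by field; apply/andP; split; lra.
rewrite e mulrA [X in _ < X]mulrAC ltr_pM2r; last by rewrite invr_gt0; lra.
rewrite -mulrA ltr_pM2l // -mulrA ltr_pM2l // exprS -mulrA ltrBlDr.
apply: le_lt_trans (_ : root2^-1 * (2 * 2 ^- l') < _); last by rewrite ltrDl.
rewrite ler_pM2l; first exact: le_trans l1; lra.
Qed.

Lemma refine_const_lt p : refine_const R K p < 5 * K%:R * p.+1%:R.
Proof.
rewrite /refine_const -/root2; have y1 := root2_gt1; have lo := root2_lower.
have k1 : 1 <= K%:R :> R by rewrite ler1n.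
have p1 : 1 <= p.+1%:R :> R by rewrite ler1n.
have kp : 1 <= K%:R * p.+1%:R :> R by rewrite mulr_ege1.
have : 2 / (root2 * (root2 - 1)) <= 4 * K%:R by rewrite ler_pdivrMr; nra.
move=> /(ler_wpM2r (ltW (lt_le_trans ltr01 p1))); lra.
Qed.

End Root.

Section ChainLength.
Variables (R : realType) (d : nat) (M0 : initial_mesh R d) (p : nat).
Variable D : seq nat.
Let K := size D.
Implicit Types (E F : edge R d) (ch : seq (edge R d)).

(** [K] times the level plus the rank of the direction index among those in [D]: a
    single number that strictly increases with the order of precedence. *)
Definition height E : nat := (K * level E + count (fun x => x < di E)%N D)%N.

Lemma count_lt_mono x y : (x < y)%N -> x \in D ->
  (count (fun z => z < x)%N D < count (fun z => z < y)%N D)%N.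
Proof.
move=> xy; elim: D => [//|z s IH]; rewrite inE /= => /orP[/eqP <-|/IH h].
  rewrite ltnn xy add0n add1n ltnS.
  by apply: sub_count => w /= wx; apply: ltn_trans wx xy.
apply: leq_ltn_trans (_ : (z < y) + count (fun z0 => z0 < x) s < _)%N.
  by rewrite leq_add2r; case: (ltnP z x) => // zx; rewrite (ltn_trans zx xy).
by rewrite ltn_add2l.
Qed.

Lemma height_lt F E : di F \in D -> precedes F E -> (height F < height E)%N.
Proof.
move=> FD; have rank_lt : (count (fun x => x < di F)%N D < K)%N.
  rewrite /K -(count_predC (fun x => x < di F)%N) -[X in (X < _)%N]addn0 ltn_add2l.
  by rewrite -has_count; apply/hasP; exists (di F) => //=; rewrite ltnn.
move=> [lt|[eq lt]]; rewrite /height.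
  have : (K * (level F).+1 <= K * level E)%N by rewrite leq_mul2l lt orbT.
  by rewrite mulnS; lia.
by rewrite eq ltn_add2l; apply: count_lt_mono.
Qed.

Lemma height_bounds E : di E \in D ->
  (K * level E <= height E)%N && (height E <= K * level E + K.-1)%N.
Proof.
move=> ED; rewrite /height leq_addr leq_add2l /=.
rewrite -ltnS prednK /K; last by case: (D) ED.
rewrite -[X in (_ < X)%N](count_predC (fun x => x < di E)%N) -[X in (X < _)%N]addn0 ltn_add2l.
by rewrite -has_count; apply/hasP; exists (di E) => //=; rewrite ltnn.
Qed.

(** Along a chain the heights increase, so the distances [2 ^- level E], which are at
    most [2 ^ ((K - 1 - height E) / K)], are summed by distinct terms of a geometric
    progression. *)
Lemma chain_near E ch : call_chain M0 p E ch -> (forall F, F \in ch -> di F \in D) ->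
  [/\ (level (head E ch) <= level E)%N, head E ch \in ch, E \in ch &
   near M0 (mid M0 E) (mid M0 (head E ch))
     (p.+1%:R / 2 * geometric R K (height (head E ch)).+1 (height E))].
Proof.
elim=> {E ch} [E dE|E F ch [lk prec] cc IH] inD.
  rewrite /= mem_head /geometric subrr mulr0 mul0r mulr0; split=> //.
  have [Q [u [du ->]]] := mid_dyadic dE.
  by apply: near_in_cell => //; rewrite subrr normr0.
have [|lF hF Fch nF] := IH; first by move=> G Gch; apply: inD; rewrite mem_rcons inE Gch orbT.
have hE : head E (rcons ch E) = head F ch by case: (ch) hF.
rewrite hE !mem_rcons !inE hF eqxx orbT; split=> //.
  by apply: leq_trans lF _; case: prec => [/ltnW|[->]].
have ED : di E \in D by apply: inD; rewrite mem_rcons mem_head.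
have FD : di F \in D by apply: inD; rewrite mem_rcons inE Fch orbT.
apply: near_le (near_trans lk nF) _; rewrite -mulrDr ler_wpM2l ?divr_ge0 //.
have K0 : (0 < K)%N by rewrite /K; case: (D) ED.
have /andP[_ hub] := height_bounds ED.
exact: geometric_step (height_lt FD prec) hub.
Qed.

End ChainLength.

Section Estimate.
Variables (R : realType) (d : nat) (M0 : initial_mesh R d) (p : nat).

Lemma num_directions_gt0 (E : edge R d) ch :
  call_chain M0 p E ch -> (0 < num_directions ch)%N.
Proof.
move=> cc; have : E \in ch by case: cc => *; rewrite ?mem_rcons mem_head.
by move=> /(map_f (@di R d)); rewrite -mem_undup /num_directions; case: undup.
Qed.

Lemma chain_estimate (E F : edge R d) ch : call_chain M0 p E ch ->
  created_near M0 (head E ch) F ->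
  (level F <= (level E).+1)%N /\
  exists2 r, near M0 (mid M0 E) (mid M0 F) r &
    r < refine_const R (num_directions ch) p * 2 ^- level F.
Proof.
move=> cc [lF nF].
set D := undup (map (@di R d) ch).
have [|lE hch Ech nE] := chain_near (D := D) cc.
  by move=> G Gch; rewrite mem_undup map_f.
have hD : di (head E ch) \in D by rewrite mem_undup map_f.
have K0 : (0 < size D)%N by case: (D) hD.
have /andP[hlow _] := height_bounds hD.
split; first exact: leq_trans lF _.
eexists; first exact: near_trans nE nF.
have := geometric_lt R K0 (height D E) hlow lF.
rewrite /refine_const /num_directions -/D -/(root2 R (size D)).
move: (geometric _ _ _ _) (2 / _) => g c gc.
have p1 : 0 < p.+1%:R :> R by rewrite ltr0n.
rewrite mulrDl addrC ltrD2l; move: gc; rewrite -(ltr_pM2l p1).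
by rewrite !mulrA [c * _]mulrC.
Qed.

End Estimate.

Theorem theorem5p2 (R : realType) :
  exists c : R,
  forall (d : nat) (M0 : initial_mesh R d) (p : nat), odd p ->
  forall M : mesh M0, generated p M ->
  forall E : edge R d, edges M E ->
  forall (M' : mesh M0) (log : call_log R d), refine p [::] M E M' log ->
  forall E' : edge R d, edges M' E' -> ~ edges M E' ->
  forall chain : seq (edge R d), log (chain, E') ->
  let K := num_directions chain in
  let C := refine_const R K p in
  [/\ (edge_dist M0 E E' < (C * 2 ^- level E')%:E)%E,
      (level E' <= (level E).+1)%N &
      C < c * K%:R * p.+1%:R].
Proof.
exists 5 => d M0 p /odd_gt0 p0 M gM E EM M' log exec E' _ _ chain logged K C.
have [_ _ logs] := refine_execution p0 exec (generated_graded p0 gM) EM.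
have [ch [e cc cr]] := logs _ _ logged; rewrite cats0 in e.
rewrite /C /K {C K logged}e.
have [lE [r nr rC]] := chain_estimate cc cr; split=> //.
- by apply: le_lt_trans (near_dist nr) _; rewrite lte_fin.
- exact/refine_const_lt/(num_directions_gt0 cc).
Qed.
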